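(* There is an absolute constant $c > 0$ such that the following holds. Consider the Erdős–Rényi model $G(n,M)$, and let $f(\omega) := \sum_{1 \le i<j<k \le n} \omega_{ij}\omega_{jk}\omega_{ik}$ be the number of triangles. Then, for any $t \ge 0$, $$\mathbb{P}(|f - \mathbb{E} f| \ge t) \le 2 \exp\Big(-c \min \Big(\frac{t^2}{n^3 + p^2 n^3 + p^4 n^4},\ \frac{t}{n^{1/2} + p n},\ t^{2/3}\Big)\Big).$$
   Context: For a number of vertices $n$, let $E = \{(i,j) : 1 \le i < j \le n\}$ be the set of possible edges, $N := |E| = n(n-1)/2$, and let $M$ be an integer with $1 \le M \le N-1$. In the model $G(n,M)$ the graph is chosen uniformly at random among all graphs on $n$ labeled vertices with exactly $M$ edges; it is identified with the vector $\omega = (\omega_e)_{e \in E} \in \{0,1\}^E$ with exactly $M$ entries equal to $1$ ($\omega_e = 1$ iff edge $e$ is present). $\mathbb{P}$ and $\mathbb{E}$ refer to this uniform distribution, and $p := M/N$. *)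

(* Defs.v *)
From HB Require Import structures.
From mathcomp Require Import all_boot all_order all_algebra.
From mathcomp Require Import reals sequences exp.

Set Implicit Arguments.
Unset Strict Implicit.
Unset Printing Implicit Defensive.

Import Order.TTheory GRing.Theory Num.Theory.

Local Open Scope ring_scope.

(* The vertices 1, ..., n are renumbered 0, ..., n - 1. *)
Definition edge (n : nat) : finType := {e : 'I_n * 'I_n | (e.1 < e.2)%N}.

Definition nb_edges (n : nat) : nat := #|{: edge n}|.

Lemma nb_edgesE (n : nat) : nb_edges n = ((n * n.-1) %/ 2)%N.
Proof.
rewrite /nb_edges card_sig -sum1_card divn2 -bin2 -bin2_sum big_mkord.
rewrite -(pair_big_dep xpredT (fun i j : 'I_n => (i < j)%N) (fun _ _ => 1%N)) /=.
rewrite (exchange_big_dep xpredT) //=.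
apply: eq_bigr => j _.
rewrite -(big_ord_widen _ (fun=> 1%N) (ltnW (ltn_ord j))).
by rewrite sum1_card card_ord.
Qed.

Definition graph (n : nat) : finType := {ffun edge n -> bool}.

Definition GnM (n M : nat) : {set graph n} :=
  [set w : graph n | #|[set e | w e]| == M].

(* The coordinate w_ij of w; only meaningful for i < j, and false otherwise. *)
Definition edge_val (n : nat) (w : graph n) (i j : 'I_n) : bool :=
  if insub (i, j) is Some e then w e else false.

Lemma edge_valE (n : nat) (w : graph n) (e : edge n) :
  edge_val w (val e).1 (val e).2 = w e.
Proof. by rewrite /edge_val -surjective_pairing valK. Qed.

Section Uniform.
Context {R : realType} {T : finType}.

Definition unif_prob (Omega : {set T}) (A : pred T) : R :=
  #|[set w in Omega | A w]|%:R / #|Omega|%:R.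

Definition unif_mean (Omega : {set T}) (X : T -> R) : R :=
  (\sum_(w in Omega) X w) / #|Omega|%:R.

End Uniform.

Definition triangles (R : realType) (n : nat) (w : graph n) : R :=
  \sum_(i < n) \sum_(j < n | (i < j)%N) \sum_(k < n | (j < k)%N)
    (edge_val w i j)%:R * (edge_val w j k)%:R * (edge_val w i k)%:R.

(* Main.v *)
Require Import Defs.
From mathcomp Require Import all_boot all_order all_algebra.
From mathcomp Require Import reals sequences exp.
From mathcomp Require Import perm ring lra zify.

(** Write [N] for the number of pairs of vertices, [beta_e = w_e - p], [B] for
    the symmetric matrix of the [beta_e], [J] for the all-ones matrix and
    [D = tr (B J B)], the sum of the squared centred degrees.  The adjacency
    matrix is [B + p (J - I)] and [6 f] is the trace of its cube.  On graphs
    with exactly [M] edges the sum of the [beta_e] vanishes and the sum of their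
    squares is constant, so the expansion of the cube collapses
    ([trianglesE]) to
        [f = constant + (p / 2) D + tr B^3 / 6].

    The moments of [D] and [tr B^3] come from the swap dynamics.  For a function
    [phi] of the graph let [L phi] be the sum, over all ordered pairs [(u, v)]
    of edges, of [phi] minus its value after exchanging the states of [u] and
    [v], and let [Gamma phi] be the sum of the squares of these differences.
    Swaps preserve the uniform law, hence summation by parts.  If [phi] is
    homogeneous of degree [a] in the [beta_e], Euler's identity and the
    vanishing sum of the [beta_e] make the first-order part of [L phi] equal to
    [2 a N phi], and the higher orders are small: [phi] is an approximate
    eigenfunction.  Testing this against the power [2 k - 1] of
    [psi = phi - E phi] and summing by parts gives
        [E psi^(2k) <= E (C k Gamma phi / N + error)^k],
    which is [ler_central_moment].

    It remains to control [Gamma].  Since the derivative of a trace in the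
    direction of an edge is twice a matrix entry, [Gamma] is bounded by [N] times a
    squared Frobenius norm:
        [Gamma D <= C N n (D + n)],
        [Gamma (tr B^3) <= C N (tr B^4 + n^2)],
        [Gamma (tr B^4) <= C N ((tr B^4)^(3/2) + n^4)].
    The first and the last are self-bounding, and testing [L phi] against powers
    of [phi] itself ([ler_moment]) yields that the norms in [L^k] of [D] and
    [tr B^4] are at most [C (n^2 + n k)] and [C (n^3 + k^2)].  The last bound is
    the key point: [tr B^4] is the fourth power of a Schatten norm of [B], which
    fluctuates by [sqrt k] around at most [n^(3/4)].  Altogether
    ([central_moment_triangles])
        [E (f - E f)^(2k) <= 2 (C k (n^3 + p^2 n^2 k + k^2))^k],
    and Markov's inequality, with [k] the integer part of a small multiple of the
    minimum in the exponent, finishes the proof. *)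

Set Implicit Arguments.
Unset Strict Implicit.

Import Order.TTheory GRing.Theory Num.Theory.
Local Open Scope ring_scope.

(** * Powers *)

(** Young's inequality without roots: compare [y] with [x]. *)
Lemma mulXX_le (R : realDomainType) (k : nat) (x y : R) :
  0 <= x -> 0 <= y -> x ^+ k * y <= x ^+ k.+1 + y ^+ k.+1.
Proof.
move=> x0 y0; have [xy|/ltW yx] := leP x y.
  apply: (@le_trans _ _ (y ^+ k.+1)); last by rewrite lerDr exprn_ge0.
  by rewrite exprSr ler_wpM2r // lerXn2r.
apply: (@le_trans _ _ (x ^+ k.+1)); last by rewrite lerDl exprn_ge0.
by rewrite exprSr ler_wpM2l // exprn_ge0.
Qed.

Lemma subXX_mul_le (R : realDomainType) (m : nat) (x y : R) :
  (x ^+ m - y ^+ m) * (x - y) <=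
    m%:R * (`|x| ^+ m.-1 + `|y| ^+ m.-1) * (x - y) ^+ 2.
Proof.
rewrite subrXX mulrC mulrA -expr2 mulrC ler_wpM2r ?sqr_ge0 //.
apply: (@le_trans _ _ (\sum_(i < m) (`|x| ^+ m.-1 + `|y| ^+ m.-1))); last first.
  by rewrite sumr_const card_ord mulr_natl.
apply: ler_sum => i _; apply: (le_trans (ler_norm _)).
rewrite normrM !normrX.
have him : (i <= m.-1)%N by rewrite -ltnS (leq_trans (ltn_ord i)) // leqSpred.
have him' : (m.-1 - i + i)%N = m.-1 by rewrite subnK.
have [xy|/ltW yx] := leP `|x| `|y|.
  apply: (@le_trans _ _ (`|y| ^+ m.-1)); last by rewrite lerDr exprn_ge0.
  by rewrite -{2}him' exprD ler_wpM2r ?exprn_ge0 // lerXn2r ?nnegrE.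
apply: (@le_trans _ _ (`|x| ^+ m.-1)); last by rewrite lerDl exprn_ge0.
by rewrite -{2}him' exprD ler_wpM2l ?exprn_ge0 // lerXn2r ?nnegrE.
Qed.

(** * Moments by summation by parts over involutions *)

Section Involutions.
Context {R : realType} {T I : finType} (Om : {set T}) (s : I -> T -> T).
Context (sK : forall i, involutive (s i)).
Context (s_Om : forall i w, (s i w \in Om) = (w \in Om)).

Definition generator (phi : T -> R) (w : T) : R := \sum_i (phi w - phi (s i w)).
Definition sq_gradient (phi : T -> R) (w : T) : R :=
  \sum_i (phi w - phi (s i w)) ^+ 2.

Lemma sum_invol (i : I) (g : T -> R) :
  \sum_(w in Om) g (s i w) = \sum_(w in Om) g w.
Proof.
rewrite [RHS](reindex_inj (inv_inj (sK i))) /=.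
by apply: eq_bigl => w; rewrite s_Om.
Qed.

Lemma sum_gen (phi : T -> R) : \sum_(w in Om) generator phi w = 0.
Proof.
rewrite exchange_big /= big1 // => i _.
by rewrite sumrB sum_invol subrr.
Qed.

(** Reversibility: the involutions preserve [Om], so each difference can be
    symmetrised. *)
Lemma dirichletE (psi phi : T -> R) :
  (\sum_(w in Om) psi w * generator phi w) *+ 2 =
  \sum_(w in Om) \sum_i (psi w - psi (s i w)) * (phi w - phi (s i w)).
Proof.
under eq_bigr do rewrite mulr_sumr.
rewrite exchange_big [RHS]exchange_big /= -sumrMnl; apply: eq_bigr => i _.
rewrite mulr2n -{2}(sum_invol i) -big_split /=; apply: eq_bigr => w _.
by rewrite sK; ring.
Qed.

(** The derivative of [x ^+ m] costs a single factor [m].  This linear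
    dependence is what produces Gaussian tails; applying a variance bound to a
    power of [psi] would give [m ^+ 2], hence only exponential ones. *)
Lemma ler_dirichlet_exp (m : nat) (psi : T -> R) :
  \sum_(w in Om) psi w ^+ m * generator psi w <=
    m%:R * \sum_(w in Om) `|psi w| ^+ m.-1 * sq_gradient psi w.
Proof.
rewrite -(ler_pMn2r (ltn0Sn 1)) dirichletE.
apply: (@le_trans _ _ (\sum_(w in Om) \sum_i m%:R *
   (`|psi w| ^+ m.-1 + `|psi (s i w)| ^+ m.-1) * (psi w - psi (s i w)) ^+ 2)).
  by apply: ler_sum => w _; apply: ler_sum => i _; apply: subXX_mul_le.
rewrite le_eqVlt; apply/orP; left; apply/eqP.
rewrite exchange_big mulr_sumr -sumrMnl.
under [RHS]eq_bigr do rewrite mulr_sumr mulr_sumr -sumrMnl.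
rewrite [RHS]exchange_big; apply: eq_bigr => i _ /=.
rewrite [RHS]sumrMnl mulr2n -[X in _ = X + _](sum_invol i) -big_split /=.
apply: eq_bigr => w _.
by rewrite sK; ring.
Qed.

(** For a nonnegative approximate eigenfunction whose squared gradient is
    controlled by the function itself, this gives an [L^(k+1)] bound by [A]:
    where [phi + B] exceeds [A], the last hypothesis lets half of the left-hand
    side absorb the gradient term; elsewhere [A] is already a bound.  The
    constant [B] is both the error in the eigenfunction relation and the shift
    that keeps the powers positive. *)
Lemma ler_moment (phi : T -> R) (Lam B A : R) (g : T -> R) (k : nat) :
  0 < Lam -> 0 < B -> 0 <= A ->
  (forall w, w \in Om -> 0 <= phi w) ->
  (forall w, w \in Om -> Lam * phi w - Lam * B <= generator phi w) ->
  (forall w, w \in Om -> sq_gradient phi w <= Lam * (phi w + B) * g w) ->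
  (forall w, w \in Om ->
     k%:R * g w + 2 * B <= Num.max (phi w + B) A / 2) ->
  \sum_(w in Om) (phi w + B) ^+ k.+1 <= \sum_(w in Om) A ^+ k.+1.
Proof.
move=> Lam0 B0 A0 phi0 hgen hsq hg.
pose U w := phi w + B.
have U0 w : w \in Om -> 0 < U w by move=> /phi0; rewrite /U; lra.
have genU w : generator U w = generator phi w.
  by apply: eq_bigr => i _; rewrite /U; ring.
have sqU w : sq_gradient U w = sq_gradient phi w.
  by apply: eq_bigr => i _; rewrite /U; congr (_ ^+ 2); ring.
have h1 : Lam * \sum_(w in Om) U w ^+ k.+1 <=
    k%:R * (\sum_(w in Om) `|U w| ^+ k.-1 * sq_gradient U w) +
    \sum_(w in Om) 2 * Lam * B * U w ^+ k.
  apply: le_trans; last by apply: lerD; [exact: ler_dirichlet_exp|exact: lexx].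
  rewrite -big_split mulr_sumr; apply: ler_sum => w wOm /=.
  have Uk : 0 <= U w ^+ k by rewrite exprn_ge0 // ltW ?U0.
  have := hgen _ wOm; rewrite genU exprSr /U in Uk * => h.
  rewrite -subr_ge0.
  suff -> : forall a b c d : R, a * b + 2 * Lam * d * a - Lam * (a * (c + d)) =
            a * (b - (Lam * c - Lam * d)) by rewrite mulr_ge0 // subr_ge0.
  by move=> *; ring.
have h2 : k%:R * (\sum_(w in Om) `|U w| ^+ k.-1 * sq_gradient U w) +
    \sum_(w in Om) 2 * Lam * B * U w ^+ k <=
    Lam / 2 * \sum_(w in Om) (U w ^+ k.+1 + A ^+ k.+1).
  rewrite !mulr_sumr -big_split; apply: ler_sum => w wOm /=.
  have Uw := U0 _ wOm; have Uk : 0 <= U w ^+ k by rewrite exprn_ge0 // ltW.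
  rewrite sqU gtr0_norm //.
  apply: (@le_trans _ _ (Lam * U w ^+ k * (k%:R * g w + 2 * B))).
    rewrite mulrDr; apply: lerD; last by rewrite le_eqVlt; apply/orP; left; apply/eqP; ring.
    case: k {h1 Uk hg} => [|k]; first by rewrite !mul0r mulr0.
    rewrite [leRHS]mulrCA ler_wpM2l ?ler0n //= exprSr.
    rewrite [leRHS](_ : _ = U w ^+ k * (Lam * U w * g w)); last by ring.
    by rewrite ler_wpM2l ?hsq // exprn_ge0 // ltW.
  apply: (@le_trans _ _ (Lam * U w ^+ k * (Num.max (U w) A / 2))).
    by rewrite ler_wpM2l ?hg // mulr_ge0 // ltW.
  rewrite [leLHS](_ : _ = Lam / 2 * (U w ^+ k * Num.max (U w) A)); last by field.
  rewrite ler_wpM2l //; first by rewrite divr_ge0 // ltW.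
  have [_|_] := leP (U w) A; first by apply: mulXX_le => //; exact: ltW.
  by rewrite exprSr lerDl exprn_ge0.
have := le_trans h1 h2; rewrite big_split /= -/U => h.
rewrite -(ler_pM2l Lam0).
by move: h; lra.
Qed.

(** The constant [c] in the eigenfunction relation costs nothing because
    [generator phi] has mean zero: averaging shows that [Lam * unif_mean Om phi]
    equals [- c] up to the same error [Lam * r]. *)
Lemma ler_central_moment (phi : T -> R) (Lam c r : R) (G : T -> R) (k : nat) :
  0 < Lam ->
  (forall w, w \in Om -> `|generator phi w - Lam * phi w - c| <= Lam * r) ->
  (forall w, w \in Om ->
     (2 * k).+1%:R * sq_gradient phi w + 4 * r ^+ 2 * Lam <= Lam * G w) ->
  \sum_(w in Om) (phi w - unif_mean Om phi) ^+ (2 * k.+1) <=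
    \sum_(w in Om) (4 * G w) ^+ k.+1.
Proof.
move=> Lam0 hgen hG.
have [Om0|Om0] := eqVneq #|Om| 0%N.
  by move: Om0 => /eqP; rewrite cards_eq0 => /eqP ->; rewrite !big_set0.
have Om0R : (#|Om|%:R : R) != 0 by rewrite pnatr_eq0.
have Om0R' : (0 : R) < #|Om|%:R by rewrite ltr0n lt0n.
set mu := unif_mean Om phi.
have hmu : #|Om|%:R * mu = \sum_(w in Om) phi w.
  by rewrite /mu /unif_mean mulrC divfK.
have hbar : `|Lam * mu + c| <= Lam * r.
  rewrite -(ler_pM2l Om0R') -[X in X * `|_|]gtr0_norm // -normrM.
  rewrite mulrDr mulrCA hmu.
  rewrite [X in `|X|](_ : _ =
      - (\sum_(w in Om) (generator phi w - Lam * phi w - c))); last first.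
    rewrite !sumrB sum_gen -mulr_sumr sumr_const -mulr_natl; ring.
  rewrite normrN (le_trans (ler_norm_sum _ _ _)) //.
  rewrite mulr_natl -sumr_const; exact: ler_sum.
pose psi w := phi w - mu.
have genpsi w : generator psi w = generator phi w.
  by apply: eq_bigr => i _; rewrite /psi; ring.
have sqpsi w : sq_gradient psi w = sq_gradient phi w.
  by apply: eq_bigr => i _; rewrite /psi; congr (_ ^+ 2); ring.
have herr w : w \in Om -> `|generator psi w - Lam * psi w| <= 2 * Lam * r.
  move=> /hgen h; rewrite genpsi /psi.
  rewrite [X in `|X|](_ : _ =
    (generator phi w - Lam * phi w - c) + (Lam * mu + c)); last by ring.
  by apply: (le_trans (ler_normD _ _)); lra.
have ev m x : (`|x| ^+ (2 * m) : R) = x ^+ (2 * m).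
  by rewrite !exprM real_normK ?num_real.
have key w : w \in Om ->
  Lam * psi w ^+ (2 * k.+1) <= psi w ^+ (2 * k).+1 * generator psi w +
     (2 * Lam * r) * `|psi w| ^+ (2 * k).+1.
  move=> wOm.
  have -> : Lam * psi w ^+ (2 * k.+1) = psi w ^+ (2 * k).+1 * generator psi w
     - psi w ^+ (2 * k).+1 * (generator psi w - Lam * psi w).
    by rewrite mulnS !exprS; ring.
  rewrite lerD2l (le_trans (ler_norm _)) // normrN normrM normrX mulrC.
  by rewrite ler_wpM2r ?exprn_ge0 ?herr.
have h1 : Lam * \sum_(w in Om) psi w ^+ (2 * k.+1) <=
   (2 * k).+1%:R * (\sum_(w in Om) `|psi w| ^+ (2 * k) * sq_gradient psi w) +
    \sum_(w in Om) (2 * Lam * r) * `|psi w| ^+ (2 * k).+1.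
  apply: le_trans; last first.
    by apply: lerD; [exact: (ler_dirichlet_exp (2 * k).+1)|exact: lexx].
  rewrite -big_split mulr_sumr; exact: ler_sum.
have h2 : (2 * k).+1%:R * (\sum_(w in Om) `|psi w| ^+ (2 * k) * sq_gradient psi w) +
    \sum_(w in Om) (2 * Lam * r) * `|psi w| ^+ (2 * k).+1 <=
   \sum_(w in Om) (Lam / 2 * psi w ^+ (2 * k.+1) + Lam / 4 * (4 * G w) ^+ k.+1).
  rewrite !mulr_sumr -big_split; apply: ler_sum => w wOm /=.
  rewrite sqpsi.
  set z := `|psi w|; have z0 : 0 <= z by exact: normr_ge0.
  have := hG _ wOm; have G0 : 0 <= G w.
    rewrite -(pmulr_rge0 _ Lam0); apply: le_trans (hG _ wOm).
    apply: addr_ge0; apply: mulr_ge0 => //; last exact: ltW.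
      by apply: sumr_ge0 => i _; exact: sqr_ge0.
    by apply: mulr_ge0 => //; exact: sqr_ge0.
  set S := sq_gradient phi w; set g := G w => hg.
  have e2 : (2 * k.+1 = 2 * k + 2)%N by rewrite mulnS addnC.
  rewrite -[psi w ^+ _]ev -/z e2 exprD [z ^+ (2 * k).+1]exprS.
  have zk : 0 <= z ^+ (2 * k) by exact: exprn_ge0.
  have zg : z ^+ (2 * k) * (4 * g) <= z ^+ (2 * k) * z ^+ 2 + (4 * g) ^+ k.+1.
    rewrite -exprD addnC -mulnS !exprM; apply: mulXX_le; rewrite ?sqr_ge0 //.
    by rewrite mulr_ge0.
  (* A quarter of [psi ^+ 2] absorbs the error term, another quarter the
     gradient term through Young's inequality. *)
  have q1 : 2 * r * z <= z ^+ 2 / 4 + 4 * r ^+ 2.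
    by have := sqr_ge0 (z / 2 - 2 * r); lra.
  have q2 : (2 * k).+1%:R * S + Lam * (2 * r * z) <=
            Lam * g + Lam * (z ^+ 2 / 4).
    have : Lam * (2 * r * z) <= Lam * (z ^+ 2 / 4 + 4 * r ^+ 2).
      by rewrite ler_pM2l.
    by move: hg; lra.
  have q3 := ler_wpM2l zk q2.
  have q4 := ler_wpM2l (ltW Lam0) zg.
  move: q3 q4; move: (z ^+ (2 * k)) ((4 * g) ^+ k.+1) => a b.
  move: ((2 * k).+1%:R : R) => m.
  lra.
have := le_trans h1 h2; rewrite big_split /= -!mulr_sumr => h.
rewrite -(ler_pM2l Lam0).
have : 0 <= Lam * \sum_(w in Om) psi w ^+ (2 * k.+1).
  by apply: mulr_ge0; [exact: ltW|apply: sumr_ge0 => w _; rewrite exprM exprn_ge0 ?sqr_ge0].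
by move: h; rewrite -/psi; lra.
Qed.

End Involutions.

(** * The squared Frobenius norm *)

Section Frobenius.
Context {R : realFieldType} {n : nat}.
Implicit Types X Y : 'M[R]_n.

Definition frob X : R := \sum_i \sum_j X i j ^+ 2.

Lemma frob_ge0 X : 0 <= frob X.
Proof. by do 2!apply: sumr_ge0 => ? _; exact: sqr_ge0. Qed.

Lemma frobE X : frob X = \tr (X *m X^T).
Proof.
rewrite /mxtrace; apply: eq_bigr => i _; rewrite mxE.
by apply: eq_bigr => j _; rewrite mxE expr2.
Qed.

Lemma frob_sym X : X^T = X -> frob X = \tr (X *m X).
Proof. by move=> hX; rewrite frobE hX. Qed.

Lemma frob_tr X : frob X^T = frob X.
Proof. by rewrite !frobE trmxK mxtrace_mulC. Qed.

Lemma frobZ a X : frob (a *: X) = a ^+ 2 * frob X.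
Proof.
rewrite /frob mulr_sumr; apply: eq_bigr => i _.
by rewrite mulr_sumr; apply: eq_bigr => j _; rewrite mxE exprMn.
Qed.

Lemma frobD_le X Y : frob (X + Y) <= 2 * frob X + 2 * frob Y.
Proof.
rewrite /frob !mulr_sumr -big_split /=; apply: ler_sum => i _.
rewrite !mulr_sumr -big_split /=; apply: ler_sum => j _; rewrite mxE.
by have := sqr_ge0 (X i j - Y i j); lra.
Qed.

Lemma cauchy_schwarz (I : finType) (x y : I -> R) :
  (\sum_i x i * y i) ^+ 2 <= (\sum_i x i ^+ 2) * (\sum_i y i ^+ 2).
Proof.
have h : 0 <= \sum_i \sum_j (x i * y j - x j * y i) ^+ 2.
  by do 2!apply: sumr_ge0 => ? _; exact: sqr_ge0.
have : \sum_i \sum_j (x i * y j - x j * y i) ^+ 2 =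
   2 * ((\sum_i x i ^+ 2) * (\sum_i y i ^+ 2) - (\sum_i x i * y i) ^+ 2).
  have e1 : \sum_i \sum_j (x i) ^+ 2 * (y j) ^+ 2 =
            (\sum_i x i ^+ 2) * (\sum_i y i ^+ 2).
    by rewrite mulr_suml; apply: eq_bigr => i _; rewrite mulr_sumr.
  have e2 : \sum_i \sum_j (x j) ^+ 2 * (y i) ^+ 2 =
            (\sum_i x i ^+ 2) * (\sum_i y i ^+ 2).
    by rewrite exchange_big.
  have e3 : \sum_i \sum_j (x i * y i) * (x j * y j) = (\sum_i x i * y i) ^+ 2.
    by rewrite expr2 mulr_suml; apply: eq_bigr => i _; rewrite mulr_sumr.
  transitivity (\sum_i \sum_j (x i) ^+ 2 * (y j) ^+ 2 +
     \sum_i \sum_j (x j) ^+ 2 * (y i) ^+ 2 -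
     2 * \sum_i \sum_j (x i * y i) * (x j * y j)); last by rewrite e1 e2 e3; ring.
  rewrite mulr_sumr -big_split -sumrB /=; apply: eq_bigr => i _.
  rewrite mulr_sumr -big_split -sumrB /=; apply: eq_bigr => j _.
  by ring.
by move=> e; move: h; rewrite e; lra.
Qed.

Lemma frob_mul X Y : frob (X *m Y) <= frob X * frob Y.
Proof.
rewrite -(frob_tr Y) /frob mulr_suml; apply: ler_sum => i _.
rewrite mulr_sumr; apply: ler_sum => j _.
rewrite mxE (le_trans (cauchy_schwarz _ _)) // ler_wpM2l //.
  by apply: sumr_ge0 => k _; exact: sqr_ge0.
by apply: ler_sum => k _; rewrite mxE.
Qed.

Lemma sqr_mxtrace_mul X Y : \tr (X *m Y) ^+ 2 <= frob X * frob Y.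
Proof.
rewrite -(frob_tr Y) /frob /mxtrace.
have -> : \sum_i (X *m Y) i i = \sum_(u : 'I_n * 'I_n) X u.1 u.2 * Y u.2 u.1.
  rewrite -(pair_bigA _ (fun i j => X i j * Y j i)).
  by apply: eq_bigr => i _; rewrite mxE.
apply: (le_trans (cauchy_schwarz _ _)).
rewrite (pair_bigA _ (fun i j => X i j ^+ 2)).
rewrite (pair_bigA _ (fun i j => (Y^T) i j ^+ 2)) /=.
rewrite le_eqVlt; apply/orP; left; apply/eqP; congr (_ * _).
by apply: eq_bigr => u _; rewrite mxE.
Qed.

Lemma mxtrace_mul_delta X i j : \tr (X *m delta_mx i j) = X j i.
Proof.
rewrite /mxtrace (bigD1 j) //= big1 ?addr0 => [|k kj]; rewrite mxE.
  rewrite (bigD1 i) //= big1 ?addr0 => [|k ki]; rewrite !mxE ?eqxx ?mulr1 //.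
  by rewrite (negbTE ki) mulr0.
by rewrite big1 // => l _; rewrite mxE (negbTE kj) andbF mulr0.
Qed.

Lemma mxtrace_prod3_tr X Y Z : \tr (X *m Y *m Z) = \tr (Z^T *m Y^T *m X^T).
Proof. by rewrite -mxtrace_tr !trmx_mul mulmxA. Qed.

End Frobenius.

(** * Symmetric matrices attached to edges *)

Section EdgeMatrices.
Context {R : realFieldType} {n : nat}.
Implicit Types (X Y : 'M[R]_n) (u v : edge n) (x y : edge n -> R).

Definition edge_mx u : 'M[R]_n :=
  delta_mx (val u).1 (val u).2 + delta_mx (val u).2 (val u).1.

Definition wmx x : 'M[R]_n := \sum_u x u *: edge_mx u.

Local Notation onemx := (const_mx 1 : 'M[R]_n).

Lemma onemx_sqr : onemx *m onemx = n%:R *: onemx.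
Proof.
apply/matrixP => i j; rewrite !mxE.
by under eq_bigr do rewrite !mxE mulr1; rewrite sumr_const card_ord mulr1.
Qed.

Lemma sum_edge_cst (a : R) : \sum_(v : edge n) a = (nb_edges n)%:R * a.
Proof. by rewrite sumr_const mulr_natl. Qed.

Lemma edge_neq u : ((val u).1 == (val u).2) = false.
Proof. by apply/negbTE; rewrite neq_ltn (valP u). Qed.

Lemma tr_edge_mx u : (edge_mx u)^T = edge_mx u.
Proof. by rewrite /edge_mx linearD /= !trmx_delta addrC. Qed.

Lemma mxtrace_edge X u :
  \tr (X *m edge_mx u) = X (val u).1 (val u).2 + X (val u).2 (val u).1.
Proof. by rewrite mulmxDr linearD /= !mxtrace_mul_delta addrC. Qed.

Lemma mxtrace_edge_sym X u :
  X^T = X -> \tr (X *m edge_mx u) = 2 * X (val u).1 (val u).2.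
Proof.
move=> hX; rewrite mxtrace_edge -[in X in _ + X]hX mxE.
by ring.
Qed.

Lemma tr_wmx x : (wmx x)^T = wmx x.
Proof. by rewrite /wmx linear_sum; apply: eq_bigr => u _; rewrite linearZ /= tr_edge_mx. Qed.

Lemma mxtrace_wmx X x : \tr (X *m wmx x) = \sum_u x u * \tr (X *m edge_mx u).
Proof.
rewrite /wmx mulmx_sumr linear_sum; apply: eq_bigr => u _.
by rewrite -scalemxAr linearZ.
Qed.

Lemma wmxE x u : wmx x (val u).1 (val u).2 = x u.
Proof.
rewrite /wmx summxE (bigD1 u) //= big1 ?addr0 => [|v vu]; rewrite !mxE.
  by rewrite !eqxx edge_neq /= addr0 mulr1.
rewrite -!xpair_eqE -!surjective_pairing.
rewrite (inj_eq val_inj) eq_sym (negbTE vu) /=.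
have [e|_] := eqVneq (val u) _; last by rewrite addr0 mulr0.
have := valP u; have := valP v; rewrite /= e /= => h1 h2.
by have := ltn_trans h1 h2; rewrite ltnn.
Qed.

Lemma wmx_diag x i : wmx x i i = 0.
Proof.
rewrite /wmx summxE big1 // => u _; rewrite !mxE.
have [->|] := eqVneq i (val u).1; first by rewrite edge_neq addr0 mulr0.
by rewrite andbF addr0 mulr0.
Qed.

(** The edge depends on the position only, so one edge serves for all weights. *)
Lemma wmx_offdiag x i j : i != j ->
  exists u, forall y, wmx y i j = y u.
Proof.
wlog ij : i j / (i < j)%N.
  move=> H; rewrite neq_ltn => /orP[] h; first by apply: H => //; rewrite neq_ltn h.
  have [|u hu] := H j i h; first by rewrite neq_ltn h.
  by exists u => y; rewrite -hu -[in RHS]tr_wmx mxE.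
by exists (Sub (i, j) ij : edge n) => y; rewrite -[RHS]wmxE SubK.
Qed.

Lemma wmx_cst : wmx (fun=> 1) = onemx - 1%:M.
Proof.
apply/matrixP => i j; rewrite !mxE.
have [->|ij] := eqVneq i j; first by rewrite wmx_diag subrr.
by have [u ->] := wmx_offdiag (fun=> 0) ij; rewrite subr0.
Qed.

Lemma wmx_le1 x i j : (forall u, `|x u| <= 1) -> `|wmx x i j| <= 1.
Proof.
move=> hx; have [->|ij] := eqVneq i j; first by rewrite wmx_diag normr0.
by have [u ->] := wmx_offdiag x ij.
Qed.

(** Both orientations of an edge are distinct off-diagonal positions; summing
    over edges is pairing the entrywise square with [J - I]. *)
Lemma sum_sqr_mxtrace_edge X : \sum_u \tr (X *m edge_mx u) ^+ 2 <= 2 * frob X.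
Proof.
pose Y : 'M[R]_n := \matrix_(i, j) X i j ^+ 2.
apply: (@le_trans _ _ (2 * \tr (Y *m wmx (fun=> 1)))).
  rewrite mxtrace_wmx mulr_sumr; apply: ler_sum => u _.
  rewrite !mxtrace_edge !mxE mul1r.
  by have := sqr_ge0 (X (val u).1 (val u).2 - X (val u).2 (val u).1); lra.
rewrite ler_pM2l // /mxtrace; apply: ler_sum => i _; rewrite mxE.
apply: ler_sum => j _; rewrite wmx_cst !mxE.
by rewrite ler_piMr ?sqr_ge0 // gerBl ler0n.
Qed.

Lemma edge_mx_sqr u : edge_mx u *m edge_mx u =
  delta_mx (val u).1 (val u).1 + delta_mx (val u).2 (val u).2.
Proof.
have e : ((val u).2 == (val u).1) = false by rewrite eq_sym edge_neq.
rewrite /edge_mx mulmxDl !mulmxDr !mul_delta_mx_cond !eqxx e edge_neq.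
by rewrite !mulr0n !mulr1n add0r addr0.
Qed.

(** [X *m edge_mx u] has only two nonzero columns; this is where a factor [n]
    is gained over submultiplicativity of the norm. *)
Lemma frob_mul_edge X u :
  (forall i j, `|X i j| <= 1) -> frob (X *m edge_mx u) <= 2 * n%:R.
Proof.
move=> hX; rewrite frobE trmx_mul tr_edge_mx mxtrace_mulC -mulmxA mxtrace_mulC.
rewrite -!mulmxA edge_mx_sqr mulmxA mulmxDr linearD /= !mxtrace_mul_delta.
have h a : (X^T *m X) a a <= n%:R.
  rewrite mxE -[n in n%:R]card_ord -sum1_card natr_sum; apply: ler_sum => i _.
  by rewrite mxE -expr2 -real_normK ?num_real // expr_le1.
by have := h (val u).1; have := h (val u).2; lra.
Qed.

(** The number of pairs (end of [u], end of [v]) that coincide, written as a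
    trace so that it can be summed over all edges at once. *)
Definition common_ends u v : R := \tr (onemx *m edge_mx u *m edge_mx v).

Lemma mxtrace_edge2 X u v (a := (val u).1) (b := (val u).2)
    (c := (val v).1) (d := (val v).2) :
  \tr (X *m edge_mx u *m edge_mx v) =
    X d a *+ (b == c) + X c a *+ (b == d) + X d b *+ (a == c) + X c b *+ (a == d).
Proof.
rewrite -mulmxA /edge_mx -/a -/b -/c -/d mulmxDl !mulmxDr.
have h (A : 'M_n) (e : bool) : \tr (X *m (A *+ e)) = \tr (X *m A) *+ e.
  by case: e; rewrite ?mulr0n ?mulmx0 ?mxtrace0.
by rewrite !mul_delta_mx_cond !linearD /= !h !mxtrace_mul_delta !addrA.
Qed.

Lemma common_ends_ge0 u v : 0 <= common_ends u v.
Proof. by rewrite /common_ends mxtrace_edge2 !mxE !addr_ge0 // mulrn_wge0. Qed.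

Lemma common_ends_le4 u v : common_ends u v <= 4.
Proof.
rewrite /common_ends mxtrace_edge2 !mxE.
by do 4!case: eqP => _; rewrite ?mulr0n ?mulr1n; lra.
Qed.

(** Second-order terms of this kind vanish unless the edges meet, which
    happens for about [n ^ 3] of the [n ^ 4] pairs of edges. *)
Lemma norm_mxtrace_edge2 X u v :
  (forall i j, `|X i j| <= 1) -> `|\tr (X *m edge_mx u *m edge_mx v)| <= common_ends u v.
Proof.
move=> hX; rewrite /common_ends !mxtrace_edge2 !mxE.
have h (b : bool) i j : `|X i j *+ b| <= 1 *+ b.
  by case: b; rewrite ?mulr1n ?mulr0n ?normr0.
do 3!(apply: (le_trans (ler_normD _ _)); apply: lerD; last exact: h).
exact: h.
Qed.

Lemma sum_common_ends : \sum_u \sum_v common_ends u v = n%:R * (n%:R - 1) ^+ 2.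
Proof.
have -> : \sum_u \sum_v common_ends u v =
   \tr (onemx *m wmx (fun=> 1) *m wmx (fun=> 1)).
  rewrite [LHS]exchange_big /= mxtrace_wmx; apply: eq_bigr => v _ /=.
  rewrite mul1r /wmx mulmx_sumr mulmx_suml linear_sum; apply: eq_bigr => u _ /=.
  by rewrite scale1r.
have oK : onemx *m (onemx - 1%:M) = (n%:R - 1) *: onemx.
  by rewrite mulmxBr onemx_sqr mulmx1 scalerBl scale1r.
have t1 : \tr onemx = n%:R.
  by rewrite /mxtrace; under eq_bigr do rewrite mxE; rewrite sumr_const card_ord.
by rewrite wmx_cst oK -scalemxAl oK scalerA mxtraceZ t1; ring.
Qed.

End EdgeMatrices.

(** * Differences of two edge matrices *)

Section EdgeDiff.
Context {R : realFieldType} {n : nat}.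
Implicit Types (X Y : 'M[R]_n) (u v : edge n).
Local Notation onemx := (const_mx 1 : 'M[R]_n).

Definition edge_diff u v : 'M[R]_n := edge_mx u - edge_mx v.

Lemma edge_mxE u : edge_mx u = wmx (fun e => (e == u)%:R) :> 'M[R]_n.
Proof.
rewrite /wmx (bigD1 u) //= eqxx scale1r big1 ?addr0 // => v /negbTE ->.
by rewrite scale0r.
Qed.

Lemma edge_diffE u v :
  edge_diff u v = wmx (fun e => (e == u)%:R - (e == v)%:R).
Proof.
rewrite /edge_diff !edge_mxE /wmx -sumrB; apply: eq_bigr => e _.
by rewrite scalerBl.
Qed.

Lemma tr_edge_diff u v : (edge_diff u v)^T = edge_diff u v.
Proof. by rewrite edge_diffE tr_wmx. Qed.

Lemma edge_diff_le1 u v i j : `|edge_diff u v i j| <= 1.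
Proof.
rewrite edge_diffE; apply: wmx_le1 => e.
by do 2!case: eqP => _; rewrite ?subrr ?subr0 ?sub0r ?normrN ?normr1 ?normr0.
Qed.

Lemma common_ends_self u : common_ends u u = 2 :> R.
Proof.
rewrite /common_ends -mulmxA edge_mx_sqr mulmxDr linearD /= !mxtrace_mul_delta !mxE.
by ring.
Qed.

Lemma mxtrace_edge2C Y u v : Y^T = Y ->
  \tr (Y *m edge_mx u *m edge_mx v) = \tr (Y *m edge_mx v *m edge_mx u).
Proof.
by move=> hY; rewrite mxtrace_prod3_tr hY !tr_edge_mx mxtrace_mulC mulmxA.
Qed.

Lemma mxtrace_edge_diff2 Y u v : Y^T = Y ->
  \tr (Y *m edge_diff u v *m edge_diff u v) =
  \tr (Y *m edge_mx u *m edge_mx u) + \tr (Y *m edge_mx v *m edge_mx v)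
    - 2 * \tr (Y *m edge_mx u *m edge_mx v).
Proof.
move=> hY; rewrite /edge_diff !(mulmxBr, mulmxBl) !linearB /=.
by rewrite (mxtrace_edge2C v u hY); ring.
Qed.

Lemma mxtrace_edge_sqr Y u : (forall i, Y i i = 0) ->
  \tr (Y *m edge_mx u *m edge_mx u) = 0.
Proof.
by move=> hY; rewrite -mulmxA edge_mx_sqr mulmxDr linearD /=
  !mxtrace_mul_delta !hY addr0.
Qed.

Lemma mxtrace_edge_diff2_hollow Y u v : Y^T = Y -> (forall i, Y i i = 0) ->
  \tr (Y *m edge_diff u v *m edge_diff u v) =
    - 2 * \tr (Y *m edge_mx u *m edge_mx v).
Proof.
by move=> hY Y0; rewrite mxtrace_edge_diff2 // !mxtrace_edge_sqr // addr0 sub0r mulNr.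
Qed.

(** A triangle of edges would need three distinct ones. *)
Lemma mxtrace_edge_diff3 u v :
  \tr (edge_diff u v *m edge_diff u v *m edge_diff u v) = 0.
Proof.
have E0 (e : edge n) i : edge_mx e i i = 0 :> R by rewrite edge_mxE wmx_diag.
rewrite mxtrace_edge_diff2_hollow; first last.
- by move=> i; rewrite edge_diffE wmx_diag.
- exact: tr_edge_diff.
rewrite /edge_diff !mulmxBl !linearB /=.
have -> : \tr (edge_mx u *m edge_mx u *m edge_mx v) = 0 :> R.
  by rewrite mxtrace_mulC mulmxA mxtrace_edge_sqr.
have -> : \tr (edge_mx v *m edge_mx u *m edge_mx v) = 0 :> R.
  by rewrite -mulmxA mxtrace_mulC mxtrace_edge_sqr.
by rewrite subr0 mulr0.
Qed.

Lemma mxtrace_onemx_edge_diff2 u v :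
  \tr (onemx *m edge_diff u v *m edge_diff u v) = 4 - 2 * common_ends u v.
Proof.
rewrite mxtrace_edge_diff2 ?trmx_const // -!/(common_ends _ _) !common_ends_self.
by ring.
Qed.

Lemma frob_mul_edge_diff X u v :
  (forall i j, `|X i j| <= 1) -> frob (X *m edge_diff u v) <= 8 * n%:R.
Proof.
move=> hX; rewrite /edge_diff mulmxBr (le_trans (frobD_le _ _)) //.
rewrite -scaleN1r frobZ sqrrN expr1n mul1r.
by have := frob_mul_edge u hX; have := frob_mul_edge v hX; lra.
Qed.

End EdgeDiff.

(** * Swapping the states of two edges *)

Section Slice.
Context {R : realType} {n M : nat} (p : R).
Implicit Types (w : graph n) (u v e : edge n).
Local Notation onemx := (const_mx 1 : 'M[R]_n).
Local Notation N := ((nb_edges n)%:R : R).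
Local Notation Om := (GnM n M).

Definition swap (uv : edge n * edge n) w : graph n :=
  [ffun e => w (tperm uv.1 uv.2 e)].

Lemma swapK uv : involutive (swap uv).
Proof. by move=> w; apply/ffunP => e; rewrite !ffunE tpermK. Qed.

Lemma swap_GnM uv w : (swap uv w \in Om) = (w \in Om).
Proof.
rewrite !inE; congr (_ == _).
rewrite -(card_imset _ (@perm_inj _ (tperm uv.1 uv.2))); congr #|pred_of_set _|.
apply/setP => e; rewrite inE; apply/imsetP/idP.
  by move=> [f]; rewrite inE ffunE => wf ->.
move=> we; exists (tperm uv.1 uv.2 e); last by rewrite tpermK.
by rewrite inE ffunE tpermK.
Qed.

Definition centered_val w e : R := (w e)%:R - p.
Definition centered_adj w : 'M[R]_n := wmx (centered_val w).

Local Notation gen := (generator swap).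
Local Notation sqgrad := (sq_gradient swap).

Lemma tr_centered_adj w : (centered_adj w)^T = centered_adj w. Proof. exact: tr_wmx. Qed.

(** The increment is a scalar multiple of a fixed sparse matrix, so increments
    of traces are polynomials in that one scalar. *)
Lemma centered_adj_swap u v w : centered_adj (swap (u, v) w) =
  centered_adj w + (centered_val w v - centered_val w u) *: edge_diff u v.
Proof.
have [->|uv] := eqVneq u v.
  rewrite subrr scale0r addr0; congr wmx; congr centered_val.
  by apply/ffunP => e; rewrite ffunE tperm1 perm1.
have vu : v != u by rewrite eq_sym.
rewrite edge_diffE /centered_adj /wmx scaler_sumr -big_split /=; apply: eq_bigr => e _.
rewrite scalerA -scalerDl; congr (_ *: _); rewrite /centered_val ffunE /=.
case: tpermP => [->|->|/eqP eu /eqP ev].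
- by rewrite eqxx (negbTE uv) /=; ring.
- by rewrite eqxx (negbTE vu) /=; ring.
- by rewrite (negbTE eu) (negbTE ev) /=; ring.
Qed.

Lemma sqr_centered_val_diff u v w : (centered_val w u - centered_val w v) ^+ 2 <= 1.
Proof. by rewrite /centered_val; case: (w u); case: (w v); rewrite /=; lra. Qed.

Lemma sum_pair_diff (x y : edge n -> R) :
  \sum_u \sum_v (x u - x v) * (y u - y v) =
    2 * N * (\sum_u x u * y u) - 2 * (\sum_u x u) * (\sum_u y u).
Proof.
transitivity (\sum_u (N * (x u * y u) + \sum_v x v * y v - x u * (\sum_v y v)
    - (\sum_v x v) * y u)).
  apply: eq_bigr => u _; rewrite -sum_edge_cst mulr_sumr mulr_suml -big_split /=.
  by rewrite -!sumrB; apply: eq_bigr => v _; ring.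
by rewrite !sumrB big_split /= sum_edge_cst -mulr_sumr -mulr_suml -mulr_sumr; ring.
Qed.

(** Here [X] is the matrix gradient of [phi] at [w] and [r] the remainder of
    order at least two. *)
Section Taylor.
Context (w : graph n) (phi : graph n -> R) (X : 'M[R]_n) (r : edge n -> edge n -> R).
Context (phiE : forall u v, phi w - phi (swap (u, v) w) =
  (centered_val w u - centered_val w v) *
    (\tr (X *m edge_mx u) - \tr (X *m edge_mx v)) - r u v).

(** Since the centred values sum to zero, the first-order part is [2 * N] times
    the derivative of [phi] in the direction of its argument, which Euler's
    identity evaluates for a homogeneous [phi]. *)
Lemma gen_taylor : \sum_u centered_val w u = 0 ->
  gen phi w = 2 * N * \tr (X *m centered_adj w) - \sum_u \sum_v r u v.
Proof.
move=> h0; rewrite /generator.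
rewrite (eq_bigr (fun uv => phi w - phi (swap (uv.1, uv.2) w))); last by case.
rewrite -(pair_bigA _ (fun u v => phi w - phi (swap (u, v) w))) /=.
under eq_bigr do under eq_bigr do rewrite phiE.
under eq_bigr do rewrite sumrB.
by rewrite sumrB sum_pair_diff h0 mulr0 mul0r subr0 mxtrace_wmx.
Qed.

Lemma sqgrad_taylor (rho : R) : (forall u v, `|r u v| <= rho) ->
  sqgrad phi w <= 12 * N * frob X + 3 * N ^+ 2 * rho ^+ 2.
Proof.
move=> hr; rewrite /sq_gradient.
rewrite (eq_bigr (fun uv => (phi w - phi (swap (uv.1, uv.2) w)) ^+ 2));
  last by case.
rewrite -(pair_bigA _ (fun u v => (phi w - phi (swap (u, v) w)) ^+ 2)) /=.
pose x u := \tr (X *m edge_mx u).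
apply: (@le_trans _ _ (\sum_u \sum_v (3 * x u ^+ 2 + 3 * x v ^+ 2 + 3 * rho ^+ 2))).
  apply: ler_sum => u _; apply: ler_sum => v _; rewrite phiE -!/(x _).
  have h1 : r u v ^+ 2 <= rho ^+ 2.
    rewrite -real_normK ?num_real // lerXn2r ?nnegrE //.
    exact: le_trans (hr u v).
  have := sqr_centered_val_diff u v w; move: (centered_val w u - centered_val w v) => d d1.
  have h2 : (x u - x v) ^+ 2 * d ^+ 2 <= (x u - x v) ^+ 2.
    by rewrite ler_piMr ?sqr_ge0.
  have := sqr_ge0 (x u + x v - d * r u v).
  have := sqr_ge0 (x u + x v).
  have := sqr_ge0 (d * (x u - x v) + r u v).
  have := sqr_ge0 (d * (x u - x v) + 2 * r u v).
  nra.
have hx : \sum_u x u ^+ 2 <= 2 * frob X := sum_sqr_mxtrace_edge X.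
have -> : \sum_u \sum_v (3 * x u ^+ 2 + 3 * x v ^+ 2 + 3 * rho ^+ 2) =
   6 * N * (\sum_u x u ^+ 2) + 3 * N ^+ 2 * rho ^+ 2.
  under eq_bigr do rewrite !big_split /= !sum_edge_cst -mulr_sumr.
  by rewrite !big_split /= !sum_edge_cst -!mulr_sumr; ring.
rewrite lerD2r [leRHS](_ : _ = 6 * N * (2 * frob X)); last by ring.
by rewrite ler_wpM2l // mulr_ge0.
Qed.

End Taylor.

End Slice.

(** * Traces of products along a line *)

Section Lines.
Context {R : comNzRingType} {n : nat}.
Implicit Types (B J H : 'M[R]_n) (d : R).

Lemma mxtrace_quad_line B J H d :
  \tr ((B + d *: H) *m J *m (B + d *: H)) = \tr (B *m J *m B) +
    d * (\tr (H *m J *m B) + \tr (B *m J *m H)) + d ^+ 2 * \tr (H *m J *m H).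
Proof.
rewrite !(mulmxDl, mulmxDr) -!(scalemxAl, scalemxAr) !linearD /= !linearZ /=.
by ring.
Qed.

Lemma mulmx_sqr_line B H d : (B + d *: H) *m (B + d *: H) =
  B *m B + (d *: (B *m H + H *m B) + d ^+ 2 *: (H *m H)).
Proof.
rewrite !(mulmxDl, mulmxDr) -!(scalemxAl, scalemxAr) scalerA -expr2 scalerDr.
by rewrite !addrA; congr (_ + _); rewrite -!addrA; congr (_ + _); rewrite addrC.
Qed.

Lemma mxtrace_cube_line B H d :
  \tr ((B + d *: H) *m (B + d *: H) *m (B + d *: H)) = \tr (B *m B *m B) +
    3 * d * \tr (B *m B *m H) + 3 * d ^+ 2 * \tr (B *m H *m H) +
    d ^+ 3 * \tr (H *m H *m H).
Proof.
have c1 : \tr (B *m H *m B) = \tr (B *m B *m H) by rewrite mxtrace_mulC mulmxA.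
have c2 : \tr (H *m B *m B) = \tr (B *m B *m H) by rewrite [RHS]mxtrace_mulC mulmxA.
have c3 : \tr (H *m B *m H) = \tr (B *m H *m H).
  by rewrite -mulmxA mxtrace_mulC.
have c4 : \tr (H *m H *m B) = \tr (B *m H *m H) by rewrite mxtrace_mulC mulmxA.
rewrite !(mulmxDl, mulmxDr) -!(scalemxAl, scalemxAr) !linearD /= !linearZ /=.
by rewrite c1 c2 c3 c4; ring.
Qed.

End Lines.

(** * Sizes on the slice *)

Section Functionals.
Context {R : realType} {n M : nat} (p : R).
Implicit Types (w : graph n) (u v e : edge n).
Local Notation onemx := (const_mx 1 : 'M[R]_n).
Local Notation N := ((nb_edges n)%:R : R).
Local Notation x := (n%:R : R).
Local Notation Om := (GnM n M).
Local Notation gen := (generator (@swap n)).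
Local Notation sqgrad := (sq_gradient (@swap n)).
Local Notation cadj := (centered_adj p).
Local Notation cval := (centered_val p).

Context (p01 : 0 <= p <= 1) (pN : p * N = M%:R) (n3 : (3 <= n)%N).

Let x3 : 3 <= x. Proof. by rewrite ler_nat. Qed.

Lemma nb_edgesR : 2 * N = x * (x - 1).
Proof.
have e : (2 * nb_edges n = n * n.-1)%N.
  rewrite mulnC nb_edgesE divnK // dvdn2 oddM.
  by case: (n) => // k; rewrite /= andNb.
rewrite -(natrM R 2) e natrM; congr (_ * _).
by rewrite -[in RHS](ltn_predK n3) -natr1 addrK.
Qed.

Lemma N_bounds : x ^+ 2 <= 3 * N /\ 2 * N <= x ^+ 2.
Proof. by have := nb_edgesR; have := x3; split; nra. Qed.

Lemma sum_centered_val w : w \in Om -> \sum_e cval w e = 0.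
Proof.
rewrite inE => /eqP wM; rewrite sumrB sumr_const -[p *+ _]mulr_natr pN -natr_sum.
have -> : (\sum_e w e = M)%N; last by rewrite subrr.
rewrite -wM -sum1_card [RHS]big_mkcond /=; apply: eq_bigr => e _.
by rewrite inE; case: (w e).
Qed.

Lemma norm_centered_val w e : `|cval w e| <= 1.
Proof.
by move: p01 => /andP[p0 p1]; rewrite /centered_val ler_norml; case: (w e) => /=; lra.
Qed.

Lemma sum_centered_val_sqr w : w \in Om ->
  \sum_e cval w e ^+ 2 = (1 - 2 * p) * M%:R + p ^+ 2 * N.
Proof.
move=> wOm.
have -> : \sum_e cval w e ^+ 2 = \sum_e ((1 - 2 * p) * cval w e + (p - p ^+ 2)).
  by apply: eq_bigr => e _; rewrite /centered_val; case: (w e) => /=; ring.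
rewrite big_split /= -mulr_sumr sum_centered_val // sumr_const -mulr_natl -/(nb_edges n) -pN.
by ring.
Qed.

Lemma norm_centered_adj w i j : `|cadj w i j| <= 1.
Proof. by apply: wmx_le1 => e; exact: norm_centered_val. Qed.

(** * Centred degrees *)

(** With [b] the vector of centred degrees, this is the sum of the [b_i ^+ 2]. *)
Definition degree_sq w : R := \tr (cadj w *m onemx *m cadj w).

Lemma frob_centered_adj_onemx w : frob (cadj w *m onemx) = x * degree_sq w.
Proof.
rewrite frobE trmx_mul trmx_const tr_centered_adj -mulmxA.
rewrite (mulmxA onemx) onemx_sqr.
by rewrite -scalemxAl -scalemxAr linearZ /= mulmxA.
Qed.

Lemma degree_sq_ge0 w : 0 <= degree_sq w.
Proof.
have := frob_ge0 (cadj w *m onemx); rewrite frob_centered_adj_onemx pmulr_rge0 //.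
by apply: lt_le_trans x3.
Qed.

Definition degree_sq_grad w := cadj w *m onemx + onemx *m cadj w.

Lemma frob_degree_sq_grad w : frob (degree_sq_grad w) <= 4 * x * degree_sq w.
Proof.
have h : frob (onemx *m cadj w) = x * degree_sq w.
  by rewrite -frob_tr trmx_mul trmx_const tr_centered_adj frob_centered_adj_onemx.
by apply: (le_trans (frobD_le _ _)); rewrite h frob_centered_adj_onemx; lra.
Qed.

Lemma degree_sq_taylor w u v : degree_sq w - degree_sq (swap (u, v) w) =
  (cval w u - cval w v) *
    (\tr (degree_sq_grad w *m edge_mx u) - \tr (degree_sq_grad w *m edge_mx v))
  - (cval w u - cval w v) ^+ 2 * (4 - 2 * common_ends u v).
Proof.
rewrite /degree_sq centered_adj_swap; set B := cadj w; set H := edge_diff u v.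
set d := cval w v - cval w u.
have -> : \tr (degree_sq_grad w *m edge_mx u) - \tr (degree_sq_grad w *m edge_mx v) =
   \tr (H *m onemx *m B) + \tr (B *m onemx *m H).
  rewrite -linearB /= -mulmxBr -/(edge_diff u v) -/H /degree_sq_grad mulmxDl linearD /= -/B addrC.
  congr (_ + _); by rewrite [RHS]mxtrace_mulC mulmxA [RHS]mxtrace_mulC mulmxA.
have <- : \tr (H *m onemx *m H) = 4 - 2 * common_ends u v.
  by rewrite -mxtrace_onemx_edge_diff2 [RHS]mxtrace_mulC mulmxA.
by rewrite mxtrace_quad_line /d; ring.
Qed.

Lemma sum_common_ends_le : \sum_(u : edge n) \sum_(v : edge n) common_ends u v <= x ^+ 3.
Proof.
rewrite sum_common_ends -subr_ge0 (_ : _ - _ = x * (2 * x - 1)); last by ring.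
by rewrite mulr_ge0 //; move: x3; lra.
Qed.

Lemma degree_sq_rest_le u v w :
  `|(cval w u - cval w v) ^+ 2 * (4 - 2 * common_ends u v)| <= 4.
Proof.
have := sqr_centered_val_diff p u v w; have := sqr_ge0 (cval w u - cval w v).
have := @common_ends_ge0 R _ u v; have := @common_ends_le4 R _ u v.
move=> t4 t0 d0 d1; rewrite normrM (ger0_norm d0).
apply: (@le_trans _ _ (1 * 4)); last by rewrite mul1r.
by apply: ler_pM => //; rewrite ler_norml; lra.
Qed.

Lemma sqgrad_degree_sq w : sqgrad degree_sq w <= 48 * N * x * degree_sq w + 48 * N ^+ 2.
Proof.
have := sqgrad_taylor (degree_sq_taylor w) (fun u v => degree_sq_rest_le u v w).
have : 12 * N * frob (degree_sq_grad w) <= 12 * N * (4 * x * degree_sq w).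
  by rewrite ler_wpM2l ?mulr_ge0 // frob_degree_sq_grad.
by move: (frob _) => f; lra.
Qed.

Lemma gen_degree_sq w : w \in Om -> gen degree_sq w = 4 * N * degree_sq w -
  \sum_u \sum_v (cval w u - cval w v) ^+ 2 * (4 - 2 * common_ends u v).
Proof.
move=> wOm; rewrite (gen_taylor (degree_sq_taylor w)) ?sum_centered_val //; congr (_ - _).
have -> : \tr (degree_sq_grad w *m cadj w) = 2 * degree_sq w; last by ring.
rewrite mulmxDl linearD /= -/(degree_sq w) [X in _ + X]mxtrace_mulC mulmxA -/(degree_sq w).
by ring.
Qed.

Lemma gen_degree_sq_ge w : w \in Om -> 4 * N * degree_sq w - 4 * N * x ^+ 2 <= gen degree_sq w.
Proof.
move=> wOm; rewrite gen_degree_sq //.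
have : \sum_u \sum_v (cval w u - cval w v) ^+ 2 * (4 - 2 * common_ends u v) <= 4 * N ^+ 2.
  apply: (@le_trans _ _ (\sum_(u : edge n) \sum_(v : edge n) 4)).
    apply: ler_sum => u _; apply: ler_sum => v _.
    exact: le_trans (ler_norm _) (degree_sq_rest_le u v w).
  by rewrite !sum_edge_cst le_eqVlt; apply/orP; left; apply/eqP; ring.
have [_ h2] := N_bounds.
have : N * N <= N * x ^+ 2 by rewrite ler_wpM2l //; have : 0 <= N by []; lra.
by move: (\sum_u _) => s; lra.
Qed.

(** The second-order term [4 * (cval w u - cval w v) ^+ 2] is of the size of the
    main term, but its sum over all swaps is constant on the slice; this is its
    opposite. *)
Definition degree_sq_cst : R := - (8 * N * ((1 - 2 * p) * M%:R + p ^+ 2 * N)).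

Lemma gen_degree_sq_center w : w \in Om ->
  `|gen degree_sq w - 4 * N * degree_sq w - degree_sq_cst| <= 4 * N * (3 / 2 * x).
Proof.
move=> wOm; rewrite gen_degree_sq //.
have -> : \sum_u \sum_v (cval w u - cval w v) ^+ 2 * (4 - 2 * common_ends u v) =
   - degree_sq_cst - 2 * \sum_u \sum_v (cval w u - cval w v) ^+ 2 * common_ends u v.
  transitivity (4 * (\sum_u \sum_v (cval w u - cval w v) * (cval w u - cval w v)) -
     2 * \sum_u \sum_v (cval w u - cval w v) ^+ 2 * common_ends u v).
    rewrite !mulr_sumr -sumrB; apply: eq_bigr => u _.
    by rewrite !mulr_sumr -sumrB; apply: eq_bigr => v _; ring.
  rewrite sum_pair_diff sum_centered_val // -(eq_bigr _ (fun e _ => expr2 (cval w e))).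
  by rewrite sum_centered_val_sqr // /degree_sq_cst; ring.
set S := \sum_u _.
have S0 : 0 <= S.
  by do 2!apply: sumr_ge0 => ? _; rewrite mulr_ge0 ?sqr_ge0 ?common_ends_ge0.
have S1 : S <= x ^+ 3.
  apply: le_trans sum_common_ends_le; do 2!apply: ler_sum => ? _.
  by rewrite ler_piMl ?common_ends_ge0 ?sqr_centered_val_diff.
have [h1 h2] := N_bounds.
rewrite [X in `|X|](_ : _ = 2 * S); last by ring.
rewrite ger0_norm ?mulr_ge0 //.
have : x * x ^+ 2 <= x * (3 * N) by rewrite ler_wpM2l.
by rewrite -exprS; lra.
Qed.

(** Self-bounding with squared gradient linear in [degree_sq]. *)
Lemma moment_degree_sq k : \sum_(w in Om) (degree_sq w + x ^+ 2) ^+ k.+1 <=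
  \sum_(w in Om) (24 * x * (k.+1%:R + x)) ^+ k.+1.
Proof.
have [h1 h2] := N_bounds; have N0 : 0 < N by move: x3; nra.
apply: (@ler_moment _ _ _ _ _ (@swapK n) (@swap_GnM n M) _ (4 * N) _ _ (fun=> 12 * x)).
- by rewrite mulr_gt0.
- by rewrite exprn_gt0 // (lt_le_trans _ x3).
- by rewrite !mulr_ge0 // addr_ge0.
- by move=> w _; exact: degree_sq_ge0.
- exact: gen_degree_sq_ge.
- move=> w _; apply: (le_trans (sqgrad_degree_sq w)).
  rewrite [leRHS](_ : _ = 48 * N * x * degree_sq w + 48 * N * x ^+ 3); last by ring.
  by rewrite lerD2l expr2 mulrA ler_wpM2l //; [rewrite mulr_ge0|move: x3; nra].
- move=> w _; apply: (@le_trans _ _ (24 * x * (k.+1%:R + x) / 2)).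
    by rewrite -natr1; move: x3; nra.
  by apply: ler_wpM2r; rewrite ?invr_ge0 ?le_max ?lexx ?orbT.
Qed.

(** Insert the moments of [degree_sq] in its own squared gradient. *)
Lemma central_moment_degree_sq k :
  \sum_(w in Om) (degree_sq w - unif_mean Om degree_sq) ^+ (2 * k.+1) <=
  \sum_(w in Om) (2304 * k.+1%:R * x ^+ 2 * (x + k.+1%:R)) ^+ k.+1.
Proof.
have [h1 h2] := N_bounds; have N0 : 0 < N by move: x3; nra.
pose G w := 24 * k.+1%:R * x * (degree_sq w + x ^+ 2).
apply: (@le_trans _ _ (\sum_(w in Om) (4 * G w) ^+ k.+1)).
  apply: (@ler_central_moment _ _ _ _ _ (@swapK n) (@swap_GnM n M) _
    (4 * N) degree_sq_cst (3 / 2 * x)).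
  - by rewrite mulr_gt0.
  - exact: gen_degree_sq_center.
  - move=> w _; have := sqgrad_degree_sq w; have := degree_sq_ge0 w.
    rewrite /G -[(2 * k).+1%:R]natr1 natrM -[k.+1%:R]natr1.
    move: (sqgrad degree_sq w) (degree_sq w) => s q q0 hs.
    have k0 : (0 : R) <= k%:R by [].
    apply: (@le_trans _ _ ((2 * k%:R + 1) * (48 * N * x * q + 48 * N ^+ 2) + 9 * x ^+ 2 * (4 * N))).
      apply: lerD; first by rewrite ler_wpM2l // addr_ge0 // mulr_ge0.
      by rewrite le_eqVlt; apply/orP; left; apply/eqP; field.
    rewrite -subr_ge0 [X in 0 <= X](_ : _ = N * (48 * x * q + (2 * k%:R + 1) * 48 * (x ^+ 2 - N) +
      (2 * k%:R + 1) * 48 * (x ^+ 3 - x ^+ 2) + 12 * x ^+ 2 * (4 * x - 3))); last by ring.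
    apply: mulr_ge0; first exact: ltW.
    have xx : x ^+ 2 <= x ^+ 3 by move: x3; nra.
    have a1 : 0 <= 48 * x * q by rewrite !mulr_ge0.
    have a2 : 0 <= (2 * k%:R + 1) * 48 * (x ^+ 2 - N).
      by apply: mulr_ge0; [lra|rewrite subr_ge0; lra].
    have a3 : 0 <= (2 * k%:R + 1) * 48 * (x ^+ 3 - x ^+ 2).
      by apply: mulr_ge0; [lra|lra].
    have a4 : 0 <= 12 * x ^+ 2 * (4 * x - 3).
      by apply: mulr_ge0; [rewrite mulr_ge0 ?sqr_ge0|move: x3; lra].
    lra.
rewrite (eq_bigr (fun w =>
  (96 * k.+1%:R * x) ^+ k.+1 * (degree_sq w + x ^+ 2) ^+ k.+1)); last first.
  by move=> w _; rewrite -exprMn /G; congr (_ ^+ _); ring.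
rewrite -mulr_sumr.
apply: le_trans (ler_wpM2l _ (moment_degree_sq k)) _; first by rewrite exprn_ge0 // !mulr_ge0.
rewrite mulr_sumr; apply: ler_sum => w _; rewrite -exprMn.
by rewrite le_eqVlt; apply/orP; left; apply/eqP; congr (_ ^+ _); ring.
Qed.


(** * Closed walks of length four *)

(** The trace of the fourth power of the centred adjacency matrix. *)
Definition walk4 w : R := frob (cadj w *m cadj w).

Lemma tr_centered_adj_sqr w : (cadj w *m cadj w)^T = cadj w *m cadj w.
Proof. by rewrite trmx_mul tr_centered_adj. Qed.

Lemma walk4E w : walk4 w = \tr (cadj w *m cadj w *m (cadj w *m cadj w)).
Proof. by rewrite /walk4 frob_sym ?tr_centered_adj_sqr. Qed.

Lemma walk4_ge0 w : 0 <= walk4 w. Proof. exact: frob_ge0. Qed.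

Definition walk4_grad w := 4 *: (cadj w *m cadj w *m cadj w).

(** With [B] the centred adjacency matrix, Cauchy-Schwarz and
    submultiplicativity bound the square of [tr B^6] by
    [frob (B^2) * frob (B^4) <= frob (B^2) ^+ 3]. *)
Lemma frob_walk4_grad w : frob (walk4_grad w) <= 16 * Num.sqrt (walk4 w) ^+ 3.
Proof.
set B := cadj w.
have h1 : frob (B *m B *m B) = \tr (B *m B *m (B *m B *m (B *m B))).
  have hB : (B *m B *m B)^T = B *m B *m B.
    by rewrite !trmx_mul !tr_centered_adj mulmxA.
  by rewrite frob_sym // !mulmxA.
have h2 : frob (B *m B *m B) ^+ 2 <= (Num.sqrt (walk4 w) ^+ 3) ^+ 2.
  rewrite -exprM mulnC exprM sqr_sqrtr ?walk4_ge0 // [leRHS]exprS h1.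
  apply: le_trans (sqr_mxtrace_mul _ _) _; rewrite ler_wpM2l ?walk4_ge0 //.
  by rewrite expr2 frob_mul.
rewrite /walk4_grad frobZ -/B (_ : 4 ^+ 2 = 16 :> R); last by ring.
by rewrite ler_wpM2l // -(@ler_pXn2r _ 2) // nnegrE ?frob_ge0 // exprn_ge0 // sqrtr_ge0.
Qed.

Definition walk4_rest w u v : R :=
  let d := cval w v - cval w u in
  2 * d ^+ 2 * frob (cadj w *m edge_diff u v) +
  frob (d *: (cadj w *m edge_diff u v + edge_diff u v *m cadj w) +
        d ^+ 2 *: (edge_diff u v *m edge_diff u v)).

Lemma walk4_taylor w u v : walk4 w - walk4 (swap (u, v) w) =
  (cval w u - cval w v) * (\tr (walk4_grad w *m edge_mx u) - \tr (walk4_grad w *m edge_mx v))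
  - walk4_rest w u v.
Proof.
rewrite -linearB /= -mulmxBr -/(edge_diff u v).
rewrite (walk4E (swap _ _)) walk4E centered_adj_swap mulmx_sqr_line /walk4_grad /walk4_rest.
have hH := tr_edge_diff u v : (edge_diff u v : 'M[R]_n)^T = _.
have hB := tr_centered_adj p w.
move: (edge_diff u v : 'M[R]_n) hH (cadj w) hB => H hH B hB.
set d := cval w v - cval w u.
have -> : cval w u - cval w v = - d by rewrite /d; ring.
set C := B *m B; set K := _ + d ^+ 2 *: _.
have hK : K^T = K.
  by rewrite /K linearD !linearZ /= linearD /= !trmx_mul hB hH; congr (_ *: _ + _); rewrite addrC.
have CK : \tr (C *m K) = 2 * d * \tr (C *m B *m H) + d ^+ 2 * frob (B *m H).
  rewrite frobE trmx_mul hH hB /K mulmxDr -!scalemxAr linearD /= !linearZ /= mulmxDr linearD /=.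
  have -> : \tr (C *m (H *m B)) = \tr (C *m B *m H).
    by rewrite /C mulmxA mxtrace_mulC !mulmxA.
  have -> : \tr (C *m (H *m H)) = \tr (B *m H *m (H *m B)).
    by rewrite /C -!mulmxA mxtrace_mulC -!mulmxA.
  by rewrite (mulmxA C B H); ring.
clearbody K; rewrite (frob_sym hK) !(mulmxDl, mulmxDr) !linearD /=.
rewrite (mxtrace_mulC K C) CK -scalemxAl linearZ /=.
by ring.
Qed.

Lemma walk4_rest_ge0 w u v : 0 <= walk4_rest w u v.
Proof.
rewrite /walk4_rest; apply: addr_ge0; last exact: frob_ge0.
by apply: mulr_ge0; [rewrite mulr_ge0 ?sqr_ge0|exact: frob_ge0].
Qed.

(** Of order [n], since every term contains a product with an edge matrix. *)
Lemma walk4_rest_le w u v : walk4_rest w u v <= 96 * x.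
Proof.
rewrite /walk4_rest; have := sqr_centered_val_diff p v u w; set d := cval w v - _ => d1.
have d0 := sqr_ge0 d.
have h1 : frob (cadj w *m edge_diff u v) <= 8 * x.
  by apply: frob_mul_edge_diff; exact: norm_centered_adj.
have h2 : frob (edge_diff u v *m edge_diff u v : 'M[R]_n) <= 8 * x.
  by apply: frob_mul_edge_diff; exact: edge_diff_le1.
have h3 : frob (edge_diff u v *m cadj w) <= 8 * x.
  by rewrite -frob_tr trmx_mul tr_edge_diff tr_centered_adj.
have h4 := frobD_le (d *: (cadj w *m edge_diff u v + edge_diff u v *m cadj w))
  (d ^+ 2 *: (edge_diff u v *m edge_diff u v)).
have h5 := frobD_le (cadj w *m edge_diff u v) (edge_diff u v *m cadj w).
rewrite !frobZ in h4.
have sm (a b : R) : 0 <= b -> a ^+ 2 <= 1 -> a ^+ 2 * b <= b.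
  by move=> b0 a1; rewrite ler_piMl.
have h6 := sm _ _ (frob_ge0 (cadj w *m edge_diff u v)) d1.
have h7 := sm _ _ (frob_ge0 (cadj w *m edge_diff u v + edge_diff u v *m cadj w)) d1.
have d2 : (d ^+ 2) ^+ 2 <= 1 by rewrite expr_le1.
have h8 := sm _ _ (frob_ge0 (edge_diff u v *m edge_diff u v : 'M[R]_n)) d2.
lra.
Qed.

Lemma gen_walk4_ge w : w \in Om ->
  8 * N * walk4 w - 8 * N * (6 * x ^+ 3) <= gen walk4 w.
Proof.
move=> wOm; rewrite (gen_taylor (walk4_taylor w)) ?sum_centered_val //.
have -> : \tr (walk4_grad w *m cadj w) = 4 * walk4 w.
  by rewrite walk4E /walk4_grad -scalemxAl linearZ /= !mulmxA.
have : \sum_u \sum_v walk4_rest w u v <= N * (N * (96 * x)).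
  apply: (@le_trans _ _ (\sum_(u : edge n) \sum_(v : edge n) 96 * x)).
    by do 2!apply: ler_sum => ? _; exact: walk4_rest_le.
  by rewrite !sum_edge_cst.
have [_ h2] := N_bounds.
have : N * x * (2 * N) <= N * x * x ^+ 2 by rewrite ler_wpM2l // mulr_ge0.
by move: (\sum_u _) => s; lra.
Qed.

Lemma sqgrad_walk4 w :
  sqgrad walk4 w <= 192 * N * Num.sqrt (walk4 w) ^+ 3 + 27 * 2 ^+ 10 * N ^+ 2 * x ^+ 2.
Proof.
have := sqgrad_taylor (walk4_taylor w) (rho := 96 * x).
have : 12 * N * frob (walk4_grad w) <= 12 * N * (16 * Num.sqrt (walk4 w) ^+ 3).
  by rewrite ler_wpM2l ?mulr_ge0 // frob_walk4_grad.
move=> h1 h2; apply: le_trans (h2 _) _; last by move: h1; lra.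
by move=> u v; rewrite ger0_norm ?walk4_rest_ge0 // walk4_rest_le.
Qed.

(** The squared gradient grows like the power [3/2] of [walk4]; this exponent
    below two gives the contribution [k ^+ 2].  With [sg] the square root of
    [walk4 + 6 n^3], the term [n^4] of the squared gradient is at most [sg ^+ 3]
    because [12 n^4 <= (6 n^3) (2 n)]. *)
Lemma moment_walk4 k : \sum_(w in Om) (walk4 w + 6 * x ^+ 3) ^+ k.+1 <=
  \sum_(w in Om) (5 * 10 ^+ 5 * (x ^+ 3 + k.+1%:R ^+ 2)) ^+ k.+1.
Proof.
have [h1 h2] := N_bounds; have N0 : 0 < N by move: x3; nra.
have x0 : 0 < x by apply: lt_le_trans x3.
have xk0 : 0 < x ^+ 3 by rewrite exprn_gt0.
pose sg w := Num.sqrt (walk4 w + 6 * x ^+ 3).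
have sgE w : sg w ^+ 2 = walk4 w + 6 * x ^+ 3.
  by rewrite sqr_sqrtr // addr_ge0 ?walk4_ge0 // mulr_ge0 // ltW.
have sg0 w : 0 <= sg w by exact: sqrtr_ge0.
apply: (@ler_moment _ _ _ _ _ (@swapK n) (@swap_GnM n M) _ (8 * N) _ _
  (fun w => 176 * sg w)).
- by rewrite mulr_gt0.
- by rewrite mulr_gt0.
- by apply: mulr_ge0; [rewrite mulr_ge0 ?exprn_ge0|rewrite addr_ge0 ?sqr_ge0 // ltW].
- by move=> w _; exact: walk4_ge0.
- exact: gen_walk4_ge.
- move=> w _; apply: (le_trans (sqgrad_walk4 w)).
  have h3 : Num.sqrt (walk4 w) ^+ 3 <= sg w ^+ 3.
    by rewrite lerXn2r ?nnegrE ?sqrtr_ge0 // ler_wsqrtr // lerDl mulr_ge0 // ltW.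
  have h4 : 2 * x <= sg w.
    rewrite -(@ler_pXn2r _ 2) ?nnegrE ?mulr_ge0 // sgE.
    have : x ^+ 2 * 3 <= x ^+ 2 * x by rewrite ler_wpM2l // sqr_ge0.
    by have := walk4_ge0 w; rewrite -exprSr; have := sqr_ge0 x; lra.
  have h5 : 12 * x ^+ 4 <= sg w ^+ 3.
    rewrite (_ : 12 * x ^+ 4 = (6 * x ^+ 3) * (2 * x)); last by ring.
    rewrite [leRHS](exprSr _ 2); apply: ler_pM => //.
    - by rewrite mulr_ge0 // ltW.
    - by rewrite mulr_ge0.
    - by rewrite sgE lerDr walk4_ge0.
  rewrite -sgE [leRHS](_ : _ = N * (1408 * sg w ^+ 3)); last by ring.
  rewrite [leLHS](_ : _ = N * (192 * Num.sqrt (walk4 w) ^+ 3 +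
    27 * 2 ^+ 9 * x ^+ 2 * (2 * N))); last by ring.
  rewrite ler_wpM2l // ?(ltW N0) //.
  have : x ^+ 2 * (2 * N) <= x ^+ 2 * x ^+ 2 by rewrite ler_wpM2l // sqr_ge0.
  rewrite -(exprD x 2 2) => h6; have := exprn_ge0 3 (sg0 w); move: h5 h3 h6.
  move: (Num.sqrt (walk4 w) ^+ 3) (sg w ^+ 3) => a b.
  rewrite [(2 + 2)%N]/=; lra.
- move=> w _; rewrite -sgE.
  set A := 5 * 10 ^+ 5 * _; set m := Num.max _ _.
  have m1 : sg w ^+ 2 <= m by rewrite le_max lexx.
  have m2 : A <= m by rewrite le_max lexx orbT.
  have m3 := sqr_ge0 (sg w - 704 * k%:R).
  have k1 : k%:R ^+ 2 <= k.+1%:R ^+ 2 :> R by rewrite lerXn2r ?nnegrE // ler_nat.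
  move: m2; rewrite /A; move: (k.+1%:R ^+ 2) k1 => K; move: (x ^+ 3) xk0 => X.
  by have := sqr_ge0 (sg w); move: m1 m3; move: (sg w) (k%:R : R) => a b; lra.
Qed.

(** * Closed walks of length three *)

Definition walk3 w : R := \tr (cadj w *m cadj w *m cadj w).
Definition walk3_grad w := 3 *: (cadj w *m cadj w).

Lemma centered_adj_diag w i : cadj w i i = 0. Proof. exact: wmx_diag. Qed.

Definition walk3_rest w u v : R :=
  - 6 * (cval w u - cval w v) ^+ 2 * \tr (cadj w *m edge_mx u *m edge_mx v).

Lemma walk3_taylor w u v : walk3 w - walk3 (swap (u, v) w) =
  (cval w u - cval w v) * (\tr (walk3_grad w *m edge_mx u) - \tr (walk3_grad w *m edge_mx v))
  - walk3_rest w u v.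
Proof.
have -> : \tr (walk3_grad w *m edge_mx u) - \tr (walk3_grad w *m edge_mx v) =
    \tr (walk3_grad w *m edge_diff u v) by rewrite mulmxBr linearB.
rewrite /walk3 centered_adj_swap mxtrace_cube_line mxtrace_edge_diff3.
rewrite mxtrace_edge_diff2_hollow ?tr_centered_adj //; last exact: centered_adj_diag.
by rewrite /walk3_grad /walk3_rest -scalemxAl linearZ /=; ring.
Qed.

Lemma walk3_rest_le w u v : `|walk3_rest w u v| <= 6 * common_ends u v.
Proof.
rewrite /walk3_rest normrM; apply: ler_pM => //; last first.
  by apply: norm_mxtrace_edge2; exact: norm_centered_adj.
rewrite normrM normrN (ger0_norm (sqr_ge0 _)) ger0_norm //.
by rewrite ler_piMr // sqr_centered_val_diff.
Qed.

(** The remainder is supported on pairs of meeting edges; summing it over pairs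
    gives [n^3] instead of [n^4], hence an error of order [n] after division by
    [6 * N]. *)
Lemma gen_walk3_center w : w \in Om ->
  `|gen walk3 w - 6 * N * walk3 w - 0| <= 6 * N * (3 * x).
Proof.
move=> wOm; rewrite (gen_taylor (walk3_taylor w)) ?sum_centered_val // subr0.
have -> : \tr (walk3_grad w *m cadj w) = 3 * walk3 w.
  by rewrite /walk3_grad -scalemxAl linearZ.
rewrite [X in `|X|](_ : _ = - \sum_u \sum_v walk3_rest w u v); last by ring.
rewrite normrN (le_trans (ler_norm_sum _ _ _)) //.
apply: (@le_trans _ _ (6 * \sum_(u : edge n) \sum_(v : edge n) common_ends u v)).
  rewrite mulr_sumr; apply: ler_sum => u _; rewrite mulr_sumr.
  rewrite (le_trans (ler_norm_sum _ _ _)) //; apply: ler_sum => v _.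
  exact: walk3_rest_le.
have := sum_common_ends_le; have [h1 _] := N_bounds.
have : x * x ^+ 2 <= x * (3 * N) by rewrite ler_wpM2l.
by rewrite -exprS; lra.
Qed.

Lemma sqgrad_walk3 w : sqgrad walk3 w <= 108 * N * walk4 w + 1728 * N ^+ 2.
Proof.
have := sqgrad_taylor (walk3_taylor w) (rho := 24).
rewrite /walk3_grad frobZ -/(walk4 w) => h; apply: le_trans (h _) _; last by lra.
move=> u v; apply: le_trans (walk3_rest_le _ _ _) _.
by have := @common_ends_le4 R _ u v; lra.
Qed.

(** The squared gradient is controlled by [walk4], whose moments are known. *)
Lemma central_moment_walk3 k :
  \sum_(w in Om) (walk3 w - unif_mean Om walk3) ^+ (2 * k.+1) <=
  \sum_(w in Om) (72 * 10 ^+ 6 * k.+1%:R * (x ^+ 3 + k.+1%:R ^+ 2)) ^+ k.+1.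
Proof.
have [h1 h2] := N_bounds; have N0 : 0 < N by move: x3; nra.
pose G w := 36 * k.+1%:R * (walk4 w + 6 * x ^+ 3).
apply: (@le_trans _ _ (\sum_(w in Om) (4 * G w) ^+ k.+1)).
  apply: (@ler_central_moment _ _ _ _ _ (@swapK n) (@swap_GnM n M) _ (6 * N) 0 (3 * x)).
  - by rewrite mulr_gt0.
  - exact: gen_walk3_center.
  - move=> w _; have := sqgrad_walk3 w; have := walk4_ge0 w.
    rewrite /G -[(2 * k).+1%:R]natr1 natrM -[k.+1%:R]natr1.
    move: (sqgrad walk3 w) (walk4 w) => s q q0 hs.
    have k0 : (0 : R) <= k%:R by [].
    apply: (@le_trans _ _ ((2 * k%:R + 1) * (108 * N * q + 1728 * N ^+ 2) + 36 * x ^+ 2 * (6 * N))).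
      apply: lerD; first by rewrite ler_wpM2l // addr_ge0 // mulr_ge0.
      by rewrite le_eqVlt; apply/orP; left; apply/eqP; ring.
    rewrite -subr_ge0 [X in 0 <= X](_ : _ = N * (108 * q +
      (2 * k%:R + 1) * 864 * (x ^+ 2 - 2 * N) +
      (2 * k%:R + 1) * 648 * x ^+ 2 * (x - 3) +
      (2 * k%:R + 1) * 1080 * x ^+ 2 + 648 * x ^+ 2 * (x - 3) +
      1728 * x ^+ 2)); last by ring.
    apply: mulr_ge0; first exact: ltW.
    by rewrite !addr_ge0 // !mulr_ge0 ?exprn_ge0 // ?subr_ge0 //; move: x3; lra.
rewrite (eq_bigr (fun w => (144 * k.+1%:R) ^+ k.+1 * (walk4 w + 6 * x ^+ 3) ^+ k.+1)); last first.
  by move=> w _; rewrite -exprMn /G; congr (_ ^+ _); ring.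
rewrite -mulr_sumr.
apply: le_trans (ler_wpM2l _ (moment_walk4 k)) _; first by rewrite exprn_ge0 // !mulr_ge0.
rewrite mulr_sumr; apply: ler_sum => w _; rewrite -exprMn.
by rewrite le_eqVlt; apply/orP; left; apply/eqP; congr (_ ^+ _); ring.
Qed.

End Functionals.

(** * Decomposition of the number of triangles *)

(** Each triple of distinct indices has exactly one increasing ordering. *)
Lemma sum_sym3 (R : comNzRingType) (n : nat) (g : 'I_n -> 'I_n -> 'I_n -> R) :
  (forall i j k, g i j k = g j i k) -> (forall i j k, g i j k = g i k j) ->
  (forall i k, g i i k = 0) ->
  \sum_i \sum_j \sum_k g i j k =
    6 * \sum_(i < n) \sum_(j < n | (i < j)%N) \sum_(k < n | (j < k)%N) g i j k.
Proof.
move=> g12 g23 g0.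
pose G (i j k : 'I_n) : R := g i j k *+ ((i < j) && (j < k))%N.
pose S (F : 'I_n -> 'I_n -> 'I_n -> R) := \sum_i \sum_j \sum_k F i j k.
have S12 F : S (fun i j k => F j i k) = S F by rewrite /S exchange_big.
have S23 F : S (fun i j k => F i k j) = S F.
  by apply: eq_bigr => i _; rewrite exchange_big.
have -> : \sum_(i < n) \sum_(j < n | (i < j)%N) \sum_(k < n | (j < k)%N) g i j k
    = S G.
  apply: eq_bigr => i _; rewrite big_mkcond; apply: eq_bigr => j _.
  rewrite /G; case: ifP => _ /=; last by rewrite big1.
  by rewrite big_mkcond; apply: eq_bigr => k _; case: ifP.
have -> : \sum_i \sum_j \sum_k g i j k = S (fun i j k => G i j k + G i k j +
    G j i k + G j k i + G k i j + G k j i).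
  apply: eq_bigr => i _; apply: eq_bigr => j _; apply: eq_bigr => k _; rewrite /G.
  have e1 : g i k j = g i j k by rewrite -g23.
  have e2 : g j i k = g i j k by rewrite -g12.
  have e3 : g j k i = g i j k by rewrite -g23 -g12.
  have e4 : g k i j = g i j k by rewrite -g12 -g23.
  have e5 : g k j i = g i j k by rewrite -g23 -g12 -g23.
  rewrite e1 e2 e3 e4 e5 -!mulrnDr.
  have [eij|ij] := eqVneq i j; first by rewrite eij g0 mul0rn.
  have [ejk|jk] := eqVneq j k; first by rewrite ejk -g12 -g23 g0 mul0rn.
  have [eik|ik] := eqVneq i k; first by rewrite eik g23 g0 mul0rn.
  rewrite [X in _ *+ X](_ : _ = 1%N) //.
  move: ij jk ik; rewrite -!(inj_eq val_inj) /=.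
  move: (nat_of_ord i) (nat_of_ord j) (nat_of_ord k) => a b c ab bc ac.
  lia.
have p1 : S (fun i j k => G i k j) = S G := S23 G.
have p2 : S (fun i j k => G j i k) = S G := S12 G.
have p3 : S (fun i j k => G j k i) = S G by rewrite (S12 (fun i j k => G i k j)).
have p4 : S (fun i j k => G k i j) = S G by rewrite (S23 (fun i j k => G j i k)).
have p5 : S (fun i j k => G k j i) = S G by rewrite (S23 (fun i j k => G j k i)).
have SD F F' : S (fun i j k => F i j k + F' i j k) = S F + S F'.
  rewrite -big_split; apply: eq_bigr => i _; rewrite -big_split.
  by apply: eq_bigr => j _; rewrite -big_split.
rewrite !SD p1 p2 p3 p4 p5; ring.
Qed.

Lemma exprD_even_le (R : realDomainType) (k : nat) (a b : R) :
  (a + b) ^+ (2 * k) <= (4 * a ^+ 2) ^+ k + (4 * b ^+ 2) ^+ k.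
Proof.
have ge0 c : 0 <= 4 * c ^+ 2 :> R by rewrite mulr_ge0 // sqr_ge0.
have ab := sqr_ge0 (a - b); rewrite exprM.
have [h|/ltW h] := leP (a ^+ 2) (b ^+ 2).
  apply: (@le_trans _ _ ((4 * b ^+ 2) ^+ k)); last by rewrite lerDr exprn_ge0.
  by apply: lerXn2r; rewrite ?nnegrE ?sqr_ge0 //; lra.
apply: (@le_trans _ _ ((4 * a ^+ 2) ^+ k)); last by rewrite lerDl exprn_ge0.
by apply: lerXn2r; rewrite ?nnegrE ?sqr_ge0 //; lra.
Qed.

Section Triangles.
Context {R : realType} {n M : nat} (p : R).
Implicit Types (w : graph n) (e : edge n).
Local Notation N := ((nb_edges n)%:R : R).
Local Notation x := (n%:R : R).
Local Notation Om := (GnM n M).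

Definition adj w : 'M[R]_n := wmx (fun e => (w e)%:R).

Lemma adjE w (i j : 'I_n) : (i < j)%N -> adj w i j = (edge_val w i j)%:R.
Proof.
move=> ij; pose e : edge n := Sub (i, j) ij.
by have := wmxE (fun e => (w e)%:R : R) e; rewrite -(edge_valE w e) SubK.
Qed.

Lemma mxtrace_adj3 w : \tr (adj w *m adj w *m adj w) = 6 * triangles R w.
Proof.
have sA i j : adj w i j = adj w j i by rewrite /adj -[in LHS]tr_wmx mxE.
pose g i j k := adj w i j * adj w j k * adj w i k.
transitivity (\sum_i \sum_j \sum_k g i j k).
  apply: eq_bigr => i _; rewrite mxE exchange_big; apply: eq_bigr => k _.
  by rewrite mxE mulr_suml; apply: eq_bigr => j _; rewrite /g (sA k i).
rewrite sum_sym3; last first.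
- by move=> i k; rewrite /g /adj wmx_diag !mul0r.
- by move=> i j k; rewrite /g (sA k j); ring.
- by move=> i j k; rewrite /g (sA j i); ring.
congr (_ * _); apply: eq_bigr => i _; apply: eq_bigr => j ij.
by apply: eq_bigr => k jk; rewrite /g !adjE // (ltn_trans ij).
Qed.

Lemma adj_centered_adj w : adj w = centered_adj p w + p *: wmx (fun=> 1).
Proof.
rewrite /adj /centered_adj /wmx scaler_sumr -big_split; apply: eq_bigr => e _ /=.
by rewrite scalerA -scalerDl /centered_val; congr (_ *: _); ring.
Qed.

Context (p01 : 0 <= p <= 1) (pN : p * N = M%:R) (n3 : (3 <= n)%N).

Definition triangles_cst : R :=
  (- 6 * p * ((1 - 2 * p) * M%:R + p ^+ 2 * N) + p ^+ 3 *
    \tr (wmx (fun=> 1) *m wmx (fun=> 1) *m wmx (fun=> 1) : 'M[R]_n)) / 6.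

(** With [K = J - I], the matrix [K ^+ 2] is a combination of [K] and [I], so
    the part linear in the centred matrix has trace zero; in the quadratic part
    only the degrees vary, as [tr B^2] is constant on the slice. *)
Lemma trianglesE w : w \in Om ->
  triangles R w = p / 2 * degree_sq p w + walk3 p w / 6 + triangles_cst.
Proof.
move=> wOm; set K : 'M[R]_n := wmx (fun=> 1); set B := centered_adj p w.
have J : const_mx 1 = K + 1%:M by rewrite /K wmx_cst subrK.
have trBE e : \tr (B *m edge_mx e) = 2 * centered_val p w e.
  by rewrite (mxtrace_edge_sym _ (tr_centered_adj p w)) /B /centered_adj wmxE.
have trB : \tr B = 0.
  by rewrite /mxtrace big1 // => i _; rewrite /B /centered_adj wmx_diag.
have trBK : \tr (B *m K) = 0.
  rewrite mxtrace_wmx (eq_bigr (fun e => 2 * centered_val p w e)); last first.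
    by move=> e _; rewrite trBE mul1r.
  by rewrite -mulr_sumr (sum_centered_val pN wOm) mulr0.
have trBB : \tr (B *m B) = 2 * ((1 - 2 * p) * M%:R + p ^+ 2 * N).
  rewrite -(sum_centered_val_sqr pN wOm) {2}/B /centered_adj mxtrace_wmx mulr_sumr.
  by apply: eq_bigr => e _; rewrite trBE; ring.
have trBKK : \tr (B *m K *m K) = 0.
  have KK : K *m K = (x - 2) *: K + (x - 1) *: 1%:M.
    move: (@onemx_sqr R n); rewrite J mulmxDl !mulmxDr mulmx1 mul1mx mulmx1 => JJ.
    have -> : K *m K = x *: (K + 1%:M) - (K + (K + 1%:M)).
      by rewrite -JJ -(addrA (K *m K) K) addrK.
    apply/matrixP => i j; rewrite !mxE; ring.
  by rewrite -mulmxA KK mulmxDr -!scalemxAr mulmx1 linearD /= !linearZ /= trBK trB !mulr0 addr0.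
have trBBK : \tr (B *m B *m K) = degree_sq p w - \tr (B *m B).
  rewrite /degree_sq -/B J mulmxDr mulmx1 mulmxDl linearD /= addrK.
  by rewrite [RHS]mxtrace_mulC mulmxA.
apply: (@mulfI _ 6); first by rewrite pnatr_eq0.
rewrite -mxtrace_adj3 adj_centered_adj -/K -/B.
rewrite mxtrace_cube_line -/(walk3 p w) trBKK trBBK trBB /triangles_cst -/K.
by field.
Qed.

(** Here [p ^+ 2 <= 1] merges the degree term [p ^+ 2 * x ^+ 3] into the term
    [x ^+ 3] of the cubic part. *)
Lemma central_moment_triangles k :
  \sum_(w in Om) (triangles R w - unif_mean Om (@triangles R n)) ^+ (2 * k.+1) <=
  2 * \sum_(w in Om) (10 ^+ 7 * k.+1%:R *
    (x ^+ 3 + p ^+ 2 * x ^+ 2 * k.+1%:R + k.+1%:R ^+ 2)) ^+ k.+1.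
Proof.
have [Om0|Om0] := eqVneq #|Om| 0%N.
  by move: Om0 => /eqP; rewrite cards_eq0 => /eqP ->; rewrite !big_set0 mulr0.
have Om0R : (#|Om|%:R : R) != 0 by rewrite pnatr_eq0.
have mean : unif_mean Om (@triangles R n) = p / 2 * unif_mean Om (degree_sq p) +
    unif_mean Om (walk3 p) / 6 + triangles_cst.
  rewrite /unif_mean (eq_bigr _ trianglesE) !big_split /= -mulr_sumr -mulr_suml.
  by rewrite sumr_const -[_ *+ _]mulr_natl; field.
have x0 : 0 <= x by [].
have K0 : 0 <= k.+1%:R :> R by [].
have p2 : p ^+ 2 <= 1 by move: p01 => /andP[? ?]; rewrite expr_le1.
pose Q := 10 ^+ 7 * k.+1%:R * (x ^+ 3 + p ^+ 2 * x ^+ 2 * k.+1%:R + k.+1%:R ^+ 2).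
rewrite -/Q.
have hd := central_moment_degree_sq pN n3 k.
have hc := central_moment_walk3 p01 pN n3 k.
set mud := unif_mean _ (degree_sq p) in mean hd; set muc := unif_mean _ (walk3 p) in mean hc.
have xk (j : nat) : 0 <= x ^+ j by rewrite exprn_ge0.
have a0 : 0 <= k.+1%:R * x ^+ 3 by rewrite mulr_ge0.
have a1 : 0 <= p ^+ 2 * x ^+ 2 * k.+1%:R ^+ 2 by rewrite -!exprMn sqr_ge0.
have a2 : 0 <= k.+1%:R ^+ 3 :> R by rewrite exprn_ge0.
have a3 : p ^+ 2 * (k.+1%:R * x ^+ 3) <= k.+1%:R * x ^+ 3 by rewrite ler_piMl.
have Q0 : 0 <= Q.
  apply: mulr_ge0; first by apply: mulr_ge0 => //; exact: exprn_ge0.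
  rewrite !addr_ge0 ?sqr_ge0 //.
  by apply: mulr_ge0 => //; apply: mulr_ge0; exact: sqr_ge0.
have qd : p ^+ 2 * (2304 * k.+1%:R * x ^+ 2 * (x + k.+1%:R)) <= Q.
  by rewrite /Q; lra.
have qc : 9^-1 * (72 * 10 ^+ 6 * k.+1%:R * (x ^+ 3 + k.+1%:R ^+ 2)) <= Q.
  by rewrite /Q; lra.
apply: (@le_trans _ _ (\sum_(w in Om) ((p ^+ 2) ^+ k.+1 * (degree_sq p w - mud) ^+ (2 * k.+1)
   + 9^-1 ^+ k.+1 * (walk3 p w - muc) ^+ (2 * k.+1)))).
  apply: ler_sum => w wOm; rewrite (trianglesE wOm) mean.
  rewrite [X in X ^+ _](_ : _ =
    p / 2 * (degree_sq p w - mud) + (walk3 p w - muc) / 6); last by ring.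
  rewrite !(exprM _ 2) -!exprMn.
  set a := p / 2 * _; set b := _ / 6.
  rewrite [X in _ <= X ^+ _ + _](_ : _ = 4 * a ^+ 2); last by rewrite /a; field.
  rewrite [X in _ <= _ + X ^+ _](_ : _ = 4 * b ^+ 2); last by rewrite /b; field.
  by rewrite -exprM; exact: exprD_even_le.
rewrite big_split /= -!mulr_sumr mulr2n mulrDl mul1r; apply: lerD.
  apply: (le_trans (ler_wpM2l _ hd)); first by rewrite exprn_ge0 ?sqr_ge0.
  rewrite mulr_sumr; apply: ler_sum => w _; rewrite -exprMn.
  apply: lerXn2r qd; rewrite nnegrE //; apply: mulr_ge0; first exact: sqr_ge0.
  apply: mulr_ge0; last exact: addr_ge0.
  by apply: mulr_ge0; [exact: mulr_ge0|exact: xk].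
apply: (le_trans (ler_wpM2l _ hc)); first by rewrite exprn_ge0 // invr_ge0.
rewrite mulr_sumr; apply: ler_sum => w _; rewrite -exprMn.
apply: lerXn2r qc; rewrite nnegrE //; apply: mulr_ge0; first by rewrite invr_ge0.
apply: mulr_ge0; last by rewrite addr_ge0 ?sqr_ge0.
by apply: mulr_ge0 => //; apply: mulr_ge0 => //; exact: exprn_ge0.
Qed.

End Triangles.

(** * Tail bound *)

Lemma markov_even (R : realType) (T : finType) (Om : {set T}) (F : T -> R)
    (t Q : R) (k : nat) :
  0 < t -> 0 <= Q -> \sum_(w in Om) F w ^+ (2 * k) <= 2 * \sum_(w in Om) Q ^+ k ->
  unif_prob Om (fun w => t <= `|F w|) <= 2 * (Q / t ^+ 2) ^+ k.
Proof.
move=> t0 Q0 hF; rewrite /unif_prob.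
have t2k : 0 < (t ^+ 2) ^+ k by rewrite !exprn_gt0.
have [Om0|Om0] := eqVneq #|Om| 0%N.
  by rewrite Om0 invr0 mulr0 mulr_ge0 // exprn_ge0 // divr_ge0 ?sqr_ge0.
have Om0R : (0 : R) < #|Om|%:R by rewrite ltr0n lt0n.
rewrite ler_pdivrMr // expr_div_n mulrA -[leRHS]mulrAC ler_pdivlMr //.
rewrite [leRHS](_ : _ = 2 * \sum_(w in Om) Q ^+ k); last first.
  by rewrite sumr_const -[Q ^+ k *+ _]mulr_natl; ring.
apply: le_trans hF; rewrite -sum1_card natr_sum mulr_suml.
rewrite (eq_bigl (fun w => (w \in Om) && (t <= `|F w|))); last first.
  by move=> w; rewrite inE.
rewrite big_mkcondr; apply: ler_sum => w _; case: ifP => tF; last first.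
  by rewrite exprM exprn_ge0 ?sqr_ge0.
rewrite mul1r exprM -(real_normK (num_real (F w))).
apply: lerXn2r; rewrite ?nnegrE ?sqr_ge0 //.
by apply: lerXn2r; rewrite ?nnegrE // ltW.
Qed.

Lemma unif_prob_le1 (R : realType) (T : finType) (Om : {set T}) (A : pred T) :
  unif_prob Om A <= 1 :> R.
Proof.
rewrite /unif_prob; have [->|Om0] := eqVneq #|Om| 0%N; first by rewrite invr0 mulr0.
rewrite ler_pdivrMr ?ltr0n ?lt0n // mul1r ler_nat subset_leq_card //.
by apply/subsetP => w; rewrite inE => /andP[].
Qed.

Lemma quarter_le_expRN1 (R : realType) : 4^-1 <= expR (- 1) :> R.
Proof.
rewrite (_ : - 1 = 2%:R * - 2^-1 :> R); last by field.
have h := expR_ge1Dx (- 2^-1 : R).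
rewrite expRM_natl (_ : 4^-1 = (2^-1) ^+ 2 :> R); last by field.
by apply: lerXn2r; rewrite ?nnegrE ?expR_ge0 ?invr_ge0 //; move: h; lra.
Qed.

(** The integer part of [z] is the moment to use.  For [z < 1] no moment is
    available, and the prefactor [2] makes the bound trivial. *)
Lemma le_expR_trunc (R : realType) (y z : R) :
  0 <= z -> y <= 1 -> (forall k, k.+1%:R <= z -> y <= 2 * 4^-1 ^+ k.+1) ->
  y <= 2 * expR (- (z / 2)).
Proof.
move=> z0 y1 hy; have [z1|z1] := ltP z 1.
  apply: (le_trans y1); have := expR_ge1Dx (- (z / 2)); move: z1; lra.
have /andP[kz zk] := truncn_itv z0.
have : (0 < Num.trunc z)%N by rewrite truncn_gt0.
case: (Num.trunc z) kz zk => // k kz zk _.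
apply: (le_trans (hy k kz)); rewrite ler_pM2l //.
apply: (@le_trans _ _ (expR (- 1) ^+ k.+1)).
  by apply: lerXn2r; rewrite ?nnegrE ?expR_ge0 ?invr_ge0 // quarter_le_expRN1.
rewrite -expRM_natl ler_expR; move: zk; rewrite -natr1.
have : (1 : R) <= k.+1%:R by rewrite ler1n.
lra.
Qed.

Theorem proposition1p3 (R : realType) :
  exists2 c : R, 0 < c &
    forall n M : nat, (1 <= M)%N -> (M <= nb_edges n - 1)%N ->
    let p : R := M%:R / (nb_edges n)%:R in
    let f : graph n -> R := @triangles R n in
    let Ef : R := unif_mean (GnM n M) f in
    let x : R := n%:R in
    forall t : R, 0 <= t ->
    unif_prob (GnM n M) (fun w => t <= `|f w - Ef|) <=
      2 * expR (- c * Num.min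
        (t ^+ 2 / (x ^+ 3 + p ^+ 2 * x ^+ 3 + p ^+ 4 * x ^+ 4))
        (Num.min (t / (powR x (1 / 2) + p * x)) (powR t (2 / 3)))).
Proof.
(* With [k.+1 <= c0 * m], each of the three terms of the moment bound is at
   most [10 ^+ 7 * c0 * t ^+ 2], and they must add up to a quarter of
   [t ^+ 2]. *)
pose c0 : R := (12 * 10 ^+ 7)^-1.
have c00 : 0 < c0 by rewrite invr_gt0 mulr_gt0 // exprn_gt0.
exists (c0 / 2); first by rewrite divr_gt0.
move=> n M M1 MN p f Ef x t t0.
have N2 : (2 <= nb_edges n)%N.
  by have := leq_trans M1 MN; rewrite subn_gt0.
have n3 : (3 <= n)%N.
  by move: N2; rewrite nb_edgesE; case: (n) => [|[|[|k]]].
have N0 : (0 : R) < (nb_edges n)%:R by rewrite ltr0n (leq_trans _ N2).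
have pN : p * (nb_edges n)%:R = M%:R by rewrite /p divfK // gt_eqF.
have p0 : 0 <= p by rewrite /p divr_ge0.
have p1 : p <= 1.
  rewrite /p ler_pdivrMr // mul1r ler_nat (leq_trans MN) //; exact: leq_subr.
have x0 : 0 < x by rewrite ltr0n (leq_trans _ n3).
set m := Num.min _ _.
have m0 : 0 <= m.
  have x30 := exprn_ge0 3 (ltW x0); have x40 := exprn_ge0 4 (ltW x0).
  rewrite !le_min powR_ge0 andbT !divr_ge0 ?sqr_ge0 //.
    by rewrite addr_ge0 ?powR_ge0 // mulr_ge0 // ltW.
  by rewrite !addr_ge0 // mulr_ge0 // exprn_ge0.
have m1 : m * x ^+ 3 <= t ^+ 2.
  have : m <= t ^+ 2 / (x ^+ 3 + p ^+ 2 * x ^+ 3 + p ^+ 4 * x ^+ 4).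
    by rewrite ge_min lexx.
  have x30 := exprn_gt0 3 x0; have x40 := exprn_gt0 4 x0.
  have h1 : 0 <= p ^+ 2 * x ^+ 3 by rewrite mulr_ge0 ?exprn_ge0 // ltW.
  have h2 : 0 <= p ^+ 4 * x ^+ 4 by rewrite mulr_ge0 ?exprn_ge0 // ltW.
  rewrite ler_pdivlMr; last by rewrite -addrA ltr_wpDr // addr_ge0.
  by apply: le_trans; rewrite ler_wpM2l // -addrA lerDl addr_ge0.
have m2 : m * (p * x) <= t.
  have : m <= t / (powR x (1 / 2) + p * x) by rewrite !ge_min lexx orbT.
  have h1 : 0 <= p * x by rewrite mulr_ge0 // ltW.
  rewrite ler_pdivlMr; last by rewrite ltr_wpDr // powR_gt0.
  by apply: le_trans; rewrite ler_wpM2l // lerDr powR_ge0.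
have m3 : m ^+ 3 <= t ^+ 2.
  have h : m <= powR t (2 / 3) by rewrite !ge_min lexx !orbT.
  have -> : t ^+ 2 = (powR t (2 / 3)) ^+ 3.
    rewrite -[RHS]powR_mulrn ?powR_ge0 // -powRrM divfK ?pnatr_eq0 //.
    by rewrite powR_mulrn.
  by apply: lerXn2r; rewrite ?nnegrE ?powR_ge0.
rewrite (_ : - (c0 / 2) * m = - (c0 * m / 2)); last by field.
apply: le_expR_trunc; first by rewrite mulr_ge0 // ltW.
  exact: unif_prob_le1.
move=> k km.
have K0 : (0 : R) < k.+1%:R by rewrite ltr0n.
have tgt0 : 0 < t.
  rewrite lt_neqAle t0 andbT; apply/eqP => tz.
  have : 0 < m by rewrite -(pmulr_rgt0 _ c00); apply: lt_le_trans km.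
  move=> mgt0; move: m3; rewrite -tz expr0n /=.
  by rewrite leNgt exprn_gt0.
set Q := 10 ^+ 7 * k.+1%:R * (x ^+ 3 + p ^+ 2 * x ^+ 2 * k.+1%:R + k.+1%:R ^+ 2).
have p01 : 0 <= p <= 1 by rewrite p0.
have Q0 : 0 <= Q.
  apply: mulr_ge0; first by apply: mulr_ge0; rewrite ?exprn_ge0.
  apply: addr_ge0; last exact: sqr_ge0.
  apply: addr_ge0; first by rewrite exprn_ge0 // ltW.
  by apply: mulr_ge0 => //; apply: mulr_ge0; exact: sqr_ge0.
apply: (le_trans (markov_even tgt0 Q0 (central_moment_triangles p01 pN n3 k))).
rewrite ler_pM2l //; apply: lerXn2r; rewrite ?nnegrE ?divr_ge0 ?invr_ge0 ?sqr_ge0 //.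
rewrite ler_pdivrMr ?exprn_gt0 //.
have c1 : c0 <= 1 by rewrite invf_le1 ?mulr_gt0 ?exprn_gt0 //; lra.
have c12 : c0 * (12 * 10 ^+ 7) = 1 by rewrite mulVf // gt_eqF // mulr_gt0 // exprn_gt0.
have q1 : k.+1%:R * x ^+ 3 <= c0 * t ^+ 2.
  apply: (@le_trans _ _ (c0 * m * x ^+ 3)); last by rewrite -mulrA ler_pM2l.
  by rewrite ler_wpM2r // exprn_ge0 // ltW.
have q2 : (k.+1%:R * (p * x)) ^+ 2 <= c0 * t ^+ 2.
  have px0 : 0 <= p * x by rewrite mulr_ge0 // ltW.
  apply: (@le_trans _ _ ((c0 * t) ^+ 2)).
    apply: lerXn2r; first by rewrite nnegrE mulr_ge0.
      by rewrite nnegrE mulr_ge0 // ltW.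
    apply: (@le_trans _ _ (c0 * m * (p * x))); last by rewrite -mulrA ler_pM2l.
    by rewrite ler_wpM2r // mulr_ge0 // ltW.
  rewrite exprMn ler_wpM2r ?sqr_ge0 // expr2 ler_piMl //; exact: ltW.
have q3 : k.+1%:R ^+ 3 <= c0 * t ^+ 2.
  apply: (@le_trans _ _ ((c0 * m) ^+ 3)).
    by apply: lerXn2r; rewrite ?nnegrE ?mulr_ge0 // ltW.
  rewrite exprMn; apply: (@le_trans _ _ (c0 * m ^+ 3)); last by rewrite ler_pM2l.
  rewrite ler_wpM2r ?exprn_ge0 // exprS ler_piMr //; first exact: ltW.
  by rewrite expr_le1 // ltW.
have q4 : t ^+ 2 = c0 * t ^+ 2 * (12 * 10 ^+ 7) by rewrite mulrAC c12 mul1r.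
rewrite q4 /Q.
rewrite [leLHS](_ : _ = 10 ^+ 7 *
  (k.+1%:R * x ^+ 3 + (k.+1%:R * (p * x)) ^+ 2 + k.+1%:R ^+ 3)); last by ring.
move: q1 q2 q3; move: (k.+1%:R * x ^+ 3) (_ ^+ 2) (k.+1%:R ^+ 3) (c0 * t ^+ 2) => a b d e.
lra.
Qed.
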